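(* Let $T$ be an automorphism of a standard probability space $(X,\mathcal{B},\mu)$. Assume that, for each $g\in L^2(X,\mathcal{B},\mu)$, there exist a sequence $(k_j)_{j\ge1}$ of positive integers going to infinity and a sequence $(S_j)_{j\ge1}$ of weakly mixing automorphisms such that, for each $j$, $T$ is a factor of the Cartesian power $S_j^{\times k_j}$, and moreover (viewing $g$ as an element of the $L^2$ space of $S_j^{\times k_j}$ via the factor map) $$\operatorname{dist}\bigl(g,L^2(\mathcal{F}_{k_j}(S_j))\bigr)=o\Bigl(\frac1{\sqrt{k_j}}\Bigr)\quad (j\to\infty).$$ Then $T$ is disjoint from every weakly mixing automorphism with the joining primeness (JP) property.
   Context: All systems are automorphisms (invertible measure-preserving transformations) of standard Borel probability spaces. For a weakly mixing automorphism $S$ of $(Y,\mathcal{C},\nu)$ and $n\ge1$, $\mathcal{F}_n(S)$ denotes the symmetric factor of $S^{\times n}=S\times\cdots\times S$ ($n$ times): the sub-$\sigma$-algebra of $\mathcal{C}^{\otimes n}$ consisting of the sets invariant under all permutations of the $n$ coordinates. $L^2(\mathcal{F}_n(S))$ is the subspace of $\mathcal{F}_n(S)$-measurable functions in $L^2(Y^n,\mathcal C^{\otimes n},\nu^{\otimes n})$, and $\operatorname{dist}$ is the $L^2$ distance. A joining of automorphisms $T$ of $(X,\mathcal{B},\mu)$ and $S$ of $(Y,\mathcal{C},\nu)$ is a $T\times S$-invariant probability measure on $X\times Y$ with marginals $\mu,\nu$; $J^e(T,S)$ is the set of ergodic joinings. $T$ and $S$ are disjoint if $\mu\otimes\nu$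 is the only joining. An ergodic automorphism $R$ of $(Z,\mathcal{D},\rho)$ has the JP property if for every pair of weakly mixing automorphisms $S_i$ of $(Y_i,\mathcal{C}_i,\nu_i)$, $i=1,2$, and every $\lambda\in J^e(R,S_1\times S_2)$, one has $\lambda=\lambda_{Z,Y_1}\otimes\nu_2$ or $\lambda=\lambda_{Z,Y_2}\otimes\nu_1$, where $\lambda_{Z,Y_i}$ is the projection of $\lambda$ on $Z\times Y_i$. *)

(* Defs.v *)
From HB Require Import structures.
From mathcomp Require Import all_boot all_order all_algebra perm.
From mathcomp Require Import all_classical all_reals all_analysis.

Set Implicit Arguments.
Unset Strict Implicit.
Unset Printing Implicit Defensive.
Import Order.TTheory GRing.Theory Num.Theory.
Import numFieldNormedType.Exports.

Local Open Scope classical_set_scope.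
Local Open Scope ring_scope.

(* The sigma-algebra of [X] is the Borel sigma-algebra of a Polish topology,
   i.e. of one that is Hausdorff, separable and given by a complete
   pseudometric; the topology is carried to [X] by the bijection [phi]. *)
Definition standard_borel (R : realType) d (X : measurableType d) : Prop :=
  exists (P : completePseudoMetricType R) (phi : X -> P),
    [/\ hausdorff_space P,
        exists2 D : set P, countable D & dense D,
        bijective phi &
        forall A : set P, measurable (phi @^-1` A) <-> <<s @open P >> A].

Definition prod_map (X Y : Type) (f : X -> X) (g : Y -> Y) (z : X * Y) : X * Y :=
  (f z.1, g z.2).

Section one_map.
Context (R : realType) d (X : measurableType d).
Variables (mu : probability X R) (f : X -> X).

Definition invertible_measure_preserving : Prop :=
  exists f' : X -> X,
    [/\ cancel f f', cancel f' f, measurable_fun [set: X] f,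
        measurable_fun [set: X] f' &
        forall A, measurable A -> mu (f @^-1` A) = mu A].

Definition ergodic : Prop :=
  forall A, measurable A -> f @^-1` A = A -> mu A = 0%E \/ mu A = 1%E.

End one_map.

Definition weakly_mixing (R : realType) d (X : measurableType d)
    (mu : probability X R) (f : X -> X) : Prop :=
  ergodic (mu \x mu)%E (prod_map f f).

Record automorphism (R : realType) := Automorphism {
  aut_display : measure_display ;
  aut_space :> measurableType aut_display ;
  aut_measure : probability aut_space R ;
  aut_map : aut_space -> aut_space ;
  aut_standard : standard_borel R aut_space ;
  aut_invertible : invertible_measure_preserving aut_measure aut_map }.

Arguments aut_map {R} a _.

Section two_maps.
Context (R : realType) d (X : measurableType d) e (Y : measurableType e).
Variables (mu : probability X R) (f : X -> X).
Variables (nu : probability Y R) (g : Y -> Y).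

(* As usual in ergodic theory, equivariance is required almost everywhere. *)
Definition factor_map (phi : X -> Y) : Prop :=
  [/\ measurable_fun [set: X] phi,
      forall B, measurable B -> mu (phi @^-1` B) = nu B &
      {ae mu, forall x, phi (f x) = g (phi x)}].

Definition joining (lam : probability (X * Y)%type R) : Prop :=
  [/\ forall A, measurable A -> lam (fst @^-1` A) = mu A,
      forall B, measurable B -> lam (snd @^-1` B) = nu B &
      forall C, measurable C -> lam (prod_map f g @^-1` C) = lam C].

Definition ergodic_joining (lam : probability (X * Y)%type R) : Prop :=
  joining lam /\ ergodic lam (prod_map f g).

Definition disjoint_systems : Prop :=
  forall lam : probability (X * Y)%type R, joining lam ->
  forall C, measurable C -> lam C = (mu \x nu)%E C.

End two_maps.

(* The two possible equalities of measures on [Z * (S1 * S2)] are stated on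
   [(Z * S1) * S2] and on [(Z * S2) * S1], after reordering coordinates. *)
Definition joining_primeness (R : realType) (Z : automorphism R) : Prop :=
  ergodic (aut_measure Z) (aut_map Z) /\
  forall S1 S2 : automorphism R,
    weakly_mixing (aut_measure S1) (aut_map S1) ->
    weakly_mixing (aut_measure S2) (aut_map S2) ->
  forall lam : probability (Z * (S1 * S2))%type R,
    ergodic_joining (aut_measure Z) (aut_map Z)
      (aut_measure S1 \x aut_measure S2)%E
      (prod_map (aut_map S1) (aut_map S2)) lam ->
  (forall C : set ((Z * S1) * S2), measurable C ->
     pushforward lam (fun w => ((w.1, w.2.1), w.2.2)) C =
     (pushforward lam (fun w => (w.1, w.2.1)) \x aut_measure S2)%E C) \/
  (forall C : set ((Z * S2) * S1), measurable C ->
     pushforward lam (fun w => ((w.1, w.2.2), w.2.1)) C =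
     (pushforward lam (fun w => (w.1, w.2.2)) \x aut_measure S1)%E C).

Section cartesian_power.
Context (R : realType) d (Y : measurableType d).

Definition tuple_cons n (z : Y * n.-tuple Y) : n.+1.-tuple Y :=
  [tuple of z.1 :: z.2].

Lemma measurable_tuple_cons n : measurable_fun setT (@tuple_cons n).
Proof. exact: measurable_cons. Qed.

HB.instance Definition _ n := @isMeasurableFun.Build _ _ _ _ (@tuple_cons n)
  (@measurable_tuple_cons n).

Variable nu : probability Y R.

Fixpoint power_measure n : probability (n.-tuple Y) R :=
  match n with
  | 0 => \d_ [tuple]
  | m.+1 => distribution (nu \x power_measure m)%E (@tuple_cons m)
  end.

Lemma power_measureE n (A : 'I_n -> set Y) : (forall i, measurable (A i)) ->
  power_measure n [set t | forall i, A i (tnth t i)] =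
  (\prod_(i < n) nu (A i))%E.
Proof.
elim: n A => [|n IHn] A mA.
  rewrite big_ord0 /= (_ : [set t | _] = setT) ?probability_setT//.
  by apply/seteqP; split=> // t _ [].
have mB : measurable [set t : n.-tuple Y | forall i, A (lift ord0 i) (tnth t i)].
  rewrite (_ : [set t | _] =
      \bigcap_(i in [set: 'I_n]) ((fun t => tnth t i) @^-1` A (lift ord0 i))).
    apply: fin_bigcap_measurable; first exact: finite_finset.
    by move=> i _; rewrite -[X in measurable X]setTI; exact: measurable_tnth.
  by apply/seteqP; split=> t /= tA i => [_|]; exact: tA.
rewrite big_ord_recl -(IHn (fun i => A (lift ord0 i)))// -product_measure1E//.
rewrite /= /distribution /pushforward; congr ((_ \x _)%E _).
apply/seteqP; split=> [[y t] /= tA|[y t] /= [Ay tA] i].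
  split=> [|i]; first by have := tA ord0; rewrite tnth0.
  by have := tA (lift ord0 i); rewrite tnthS.
case: (unliftP ord0 i) => [j|] ->; last by rewrite tnth0.
by rewrite tnthS; exact: tA.
Qed.

Definition power_map n (f : Y -> Y) (t : n.-tuple Y) : n.-tuple Y :=
  [tuple of map f t].

Definition permute_coord n (s : 'S_n) (t : n.-tuple Y) : n.-tuple Y :=
  [tuple tnth t (s i) | i < n].

Definition symmetric_factor n : set (set (n.-tuple Y)) :=
  [set A | measurable A /\ forall s : 'S_n, permute_coord s @^-1` A = A].
Arguments symmetric_factor n : clear implicits.

(* Real scalars: for real [g] the distance to the complex space is the same,
   the real part of a symmetric function being symmetric. *)
Definition L2_symmetric n : set (n.-tuple Y -> R) :=
  [set h | h \in Lfun (power_measure n) 2%:E /\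
    forall B : set R, measurable B -> symmetric_factor n (h @^-1` B)].
Arguments L2_symmetric n : clear implicits.

Definition dist_L2_symmetric n (g : n.-tuple Y -> R) : R :=
  inf [set fine ('N[power_measure n]_2%:E [EFin \o (g \- h)%R])%E |
       h in L2_symmetric n].

End cartesian_power.
Arguments power_map {d Y} n f t.

(* Main.v *)
Require Import Defs.
From HB Require Import structures.
From mathcomp Require Import all_boot all_order all_algebra perm.
From mathcomp Require Import all_classical all_reals all_analysis.
From mathcomp Require Import measurable_realfun.
From mathcomp Require Import ring lra.

(** Let [lam] be a joining of [T] and [Z], let [A] and [E] be events of the two systems, and
    let [T] be a factor of [S^n] along [phi]. It suffices to bound [lam (A `*` E)] by
    [mu A * rho E] up to an error that tends to [0] along the sequence of the hypothesis
    for the indicator of [A]: the same bound for the complement of [A] then turns the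
    inequality into an equality, and measurable rectangles determine [lam]
    ([joining_le_disjoint]).

    The joining lifts to a joining of [Z] and [S^n], the relatively independent one over
    [T]; it gives [E `*` phi @^-1` A] the same mass ([lift_joining]). It need not be
    ergodic, so it is replaced by an ergodic joining that gives this rectangle at least as
    much mass ([ergodic_joining_above]). For that, joinings are viewed as biadditive
    functions of two measurable sets with the right marginals. They form a closed subset of
    a product of unit intervals, which is compact by Tychonoff's theorem; a point of it that
    is extreme and maximizes the given coordinate exists by Zorn's lemma on faces; extreme
    joinings are ergodic. On standard Borel spaces inner regularity by compact sets makes
    every such biadditive function a measure ([coupling_of_precoupling]), so that no
    topology on the phase spaces is involved in the compactness argument.

    Splitting one factor at a time off [S^n = S * S^n-1], joining primeness shows that an
    ergodic joining [lam'] of [Z] and [S^n] has the property that [lam' (E `*` _)] has a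
    density with respect to the power measure which depends on a single coordinate
    ([jp_power]). All the systems that occur are weakly mixing, since powers of a weakly
    mixing system are ([power_weakly_mixing]).

    Finally a single coordinate carries little information on a nearly symmetric event [D].
    If [h] takes values in [[0, 1]] with mean [c], exchanging coordinates changes the
    integral of [h (tnth t i)] over [D] by at most twice the [L1] distance from the
    indicator of [D] to a symmetric function. The integral is thus close to the average over
    [i], and by the variance bound the average of [h (tnth t i) - c] over [i] has mean
    absolute value at most [1 / sqrt n]. With [c = rho E] and [D = phi @^-1` A] this is the
    bound wanted ([one_coordinate_bound], [joining_rectangle_le]). *)

Set Implicit Arguments.
Unset Strict Implicit.
Unset Printing Implicit Defensive.
Import Order.TTheory GRing.Theory Num.Theory.
Import numFieldNormedType.Exports.
Local Open Scope classical_set_scope.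
Local Open Scope ring_scope.

(** * Regularity of probability measures on standard Borel spaces *)

Lemma small_inv (R : realType) (e : R) : 0 < e -> exists n, (n.+1%:R^-1 : R) < e.
Proof. by move=> /ltr_add_invr[n]; rewrite add0r; exists n. Qed.

Lemma exhaust_measure (R : realType) d (X : measurableType d) (mu : probability X R)
  (A : set X) (F : (set X)^nat) (e : R) :
  measurable A -> (forall n, measurable (F n)) ->
  {homo F : m n / (m <= n)%N >-> m `<=` n} -> A `<=` \bigcup_n F n -> 0 < e ->
  exists n, (mu (A `\` F n) <= e%:E)%E.
Proof.
move=> mA mF ndF AF e0.
pose G n := A `\` F n.
have mG n : measurable (G n) by exact: measurableD.
have G0 : \bigcap_n G n = set0.
  rewrite -subset0 => x Gx; have [Ax _] := Gx 0%N I.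
  by have [n _ Fnx] := AF x Ax; have [_] := Gx n I.
have : mu \o G @ \oo --> mu (\bigcap_n G n).
  apply: nonincreasing_cvg_mu => //.
  - by rewrite (le_lt_trans (probability_le1 mu _)) ?ltry.
  - exact: bigcapT_measurable.
  - by move=> m n mn; apply/subsetPset; apply: setDS; exact: ndF.
rewrite G0 measure0 => /fine_cvgP[fG /cvgr0Pnorm_lt/(_ e e0) lG].
have : \forall n \near \oo, (mu (G n) <= e%:E)%E.
  near=> n.
  have fn : mu (G n) \is a fin_num by near: n.
  rewrite -(fineK fn) lee_fin; apply/ltW/(le_lt_trans (ler_norm _)).
  by near: n.
by case=> n _ /(_ n (leqnn _)); exists n.
Unshelve. all: end_near. Qed.

Section regularity.
Context (R : realType) d (X : measurableType d) (mu : probability X R).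
Context (P : completePseudoMetricType R) (phi : X -> P).
Hypothesis phi_borel : forall B : set P, <<s @open P >> B -> measurable (phi @^-1` B).

Let open_phi (V : set P) : open V -> measurable (phi @^-1` V).
Proof. by move=> oV; apply: phi_borel; exact: sub_sigma_algebra. Qed.

Let closed_phi (F : set P) : closed F -> measurable (phi @^-1` F).
Proof.
by move=> /closed_openC/open_phi/measurableC; rewrite -preimage_setC setCK.
Qed.

Let diff_phi (V F : set P) : open V -> closed F -> measurable (phi @^-1` (V `\` F)).
Proof. by move=> oV cF; apply: measurableD; [exact: open_phi|exact: closed_phi]. Qed.

(** Approximation from inside by closed sets and from outside by open sets; the sets with
    this property form a sigma-algebra that contains the open sets. *)
Definition regular_for (A : set P) := forall e : R, 0 < e ->
  exists F V : set P, [/\ closed F, open V, F `<=` A, A `<=` V &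
    (mu (phi @^-1` (V `\` F)) <= e%:E)%E].

(** An open set is the increasing union of the closures of the sets of points that have a
    ball of radius [1 / n] in it. *)
Lemma regular_for_open (V : set P) : open V -> regular_for V.
Proof.
move=> oV e e0.
pose F (n : nat) := closure [set x | ball x (n.+1%:R^-1 : R) `<=` V].
have ndF : {homo F : m n / (m <= n)%N >-> m `<=` n}.
  move=> m n mn; apply: closureS => x /= bV; apply: subset_trans bV.
  by apply: le_ball; rewrite lef_pV2 ?posrE// ler_nat.
have FV n : F n `<=` V.
  move=> x Fx.
  have [|y [/= yV xy]] := Fx (ball x (n.+1%:R^-1 : R)).
    exact: nbhsx_ballx.
  by apply: yV; exact: ball_sym.
have VF : V `<=` \bigcup_n F n.
  move=> x Vx; have /nbhs_ballP[r/= r0 rV] := open_nbhs_nbhs (conj oV Vx).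
  have [n nr] := small_inv r0.
  exists n => //; apply: subset_closure => /=; apply: subset_trans rV.
  exact/le_ball/ltW.
have [n ne] := exhaust_measure (A := phi @^-1` V) (F := fun n => phi @^-1` F n) mu
  (open_phi oV) (fun n => closed_phi (@closed_closure _ _))
  (fun m n mn x => ndF _ _ mn (phi x))
  (fun x Vx => VF _ Vx) e0.
exists (F n), V; split => //; exact: closed_closure.
Qed.

Lemma regular_forC A : regular_for A -> regular_for (~` A).
Proof.
move=> rA e /rA[F [V [cF oV FA AV FVe]]].
exists (~` V), (~` F); split; [exact: open_closedC|exact: closed_openC|
  exact: subsetC|exact: subsetC|].
by rewrite setDE setCK setIC -setDE.
Qed.

(** The union of the inner closed sets need not be closed, so finitely many of them are
    kept; half of the error pays for the others. *)
Lemma regular_for_bigcup (A : (set P)^nat) :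
  (forall n, regular_for (A n)) -> regular_for (\bigcup_n A n).
Proof.
move=> rA e e0.
have e20 (n : nat) : 0 < e / 2 / (2 ^ n.+1)%:R by rewrite !divr_gt0// ltr0n expn_gt0.
have /choice[F /choice[V FV]] n := rA n _ (e20 n).
have cF n : closed (F n) by have [] := FV n.
have oV n : open (V n) by have [] := FV n.
pose W := \bigcup_n V n; pose G n := \bigcup_(i < n) F i.
have cG n : closed (G n).
  by rewrite /G bigcup_mkord; apply: big_ind => //; [exact: closed0|exact: closedU].
have oW : open W by apply: bigcup_open.
pose G' := \bigcup_n F n.
have mG' : measurable (phi @^-1` G').
  by rewrite preimage_bigcup; apply: bigcup_measurable => n _; exact: closed_phi.
have e2 : 0 < e / 2 by rewrite divr_gt0.
have [|||n nG] := exhaust_measure (A := phi @^-1` G') (F := fun n => phi @^-1` (G n))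
  mu mG' _ _ _ e2.
- by move=> n; exact: closed_phi.
- move=> m n mn x [i/= im Fi]; exists i => //=; exact: leq_trans mn.
- by move=> x [i _ Fi]; exists i.+1 => //; exists i => //=.
exists (G n), W; split => //.
- by move=> x [i _ Fx]; exists i => //; have [_ _ + _ _] := FV i; apply.
- by move=> x [i _ Ax]; exists i => //; have [_ _ _ + _] := FV i; apply.
apply: (@le_trans _ _ (mu ((\bigcup_n (phi @^-1` (V n `\` F n))) `|` (phi @^-1` G' `\` phi @^-1`
  (G n))))%E).
  apply: le_measure; rewrite ?inE.
  - exact: diff_phi.
  - apply: measurableU.
      by apply: bigcup_measurable => k _; exact: diff_phi.
    by apply: measurableD => //; exact: closed_phi.
  - move=> x [[i _ /= Vi] nGx].
    have [G'x|G'x] := pselect (G' (phi x)); first by right.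
    by left; exists i => //; split => // Fi; apply: G'x; exists i.
apply: le_trans (measureU2 _ _ _) _.
- by apply: bigcup_measurable => k _; exact: diff_phi.
- by apply: measurableD => //; exact: closed_phi.
rewrite [in leRHS](splitr e) EFinD; apply: leeD nG.
apply: le_trans (@measure_sigma_subadditive _ _ _ mu _ (fun n => phi @^-1` (V n `\` F n)) _ _
  (@subset_refl _ _)) _.
- by move=> k; exact: diff_phi.
- by apply: bigcup_measurable => k _; exact: diff_phi.
apply: le_trans (epsilon_trick0 xpredT (ltW e2)).
by apply: lee_nneseries => // i _; have [] := FV i.
Qed.

Lemma borel_regular (A : set P) : <<s @open P >> A -> regular_for A.
Proof.
apply; split; last exact: regular_for_open; split.
- exact/regular_for_open/open0.
- by move=> B rB; rewrite setTD; exact: regular_forC.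
- exact: regular_for_bigcup.
Qed.

(** Ulam's argument: finitely many balls of radius [1 / n] cover all of the space but a set
    of small measure, and an intersection over [n] of such finite unions is totally bounded,
    hence compact by completeness. *)
Lemma tight_measure : (exists2 D : set P, countable D & dense D) ->
  forall e : R, 0 < e -> exists K : set P,
    [/\ closed K, compact K & (mu (phi @^-1` (~` K)) <= e%:E)%E].
Proof.
move=> [D /pcard_surjP[q Dq] dD] e e0.
have e20 (n : nat) : 0 < e / (2 ^ n.+1)%:R by rewrite divr_gt0// ltr0n expn_gt0.
pose C (n k : nat) : set P := closure (ball (q k) (n.+1%:R^-1 : R)).
pose U n k : set P := \bigcup_(i < k) C n i.
have cU n k : closed (U n k).
  rewrite /U bigcup_mkord; apply: big_ind => //; [exact: closed0|exact: closedU|].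
  by move=> i _; exact: closed_closure.
have /choice[N UN] n : exists k, (mu (phi @^-1` (~` U n k)) <= (e / (2 ^ n.+1)%:R)%:E)%E.
  have [|||k ke] := exhaust_measure (A := setT) (F := fun k => phi @^-1` (U n k))
    mu measurableT _ _ _ (e20 n).
  - by move=> k; exact: closed_phi.
  - by move=> k l kl x [i/= im Fi]; exists i => //=; exact: leq_trans kl.
  - move=> x _.
    have n0 : 0 < (n.+1%:R^-1 : R) by rewrite invr_gt0.
    have [||y [yx Dy]] := dD (ball (phi x) (n.+1%:R^-1 : R))°.
    + by exists (phi x); apply: nbhs_singleton; apply: nbhs_interior; exact: nbhsx_ballx.
    + exact: open_interior.
    have [i _ iy] := Dq y Dy; exists i.+1 => //; exists i => //=.
    by apply: subset_closure; rewrite iy; apply: ball_sym; exact: interior_subset yx.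
  by exists k; move: ke; rewrite setTD.
pose K : set P := \bigcap_n U n (N n).
have cK : closed K by apply: closed_bigI => n _.
exists K; split => //.
  rewrite compact_ultra => F UF FK.
  have cF : cauchy F.
    apply: cauchy_exP => r r0.
    have [|n nr] := @small_inv _ (r / 2); first by rewrite divr_gt0.
    have FU : F (U n (N n)) by apply: filterS FK => x; apply.
    have : exists k, F (C n k).
      move: FU; rewrite /U bigcup_mkord; elim: (N n) => [|m IH].
        by rewrite big_ord0 => /filter_not_empty.
      rewrite big_ord_recr/= => FU.
      have [FC|FC] := @in_ultra_setVsetC _ _ (C n m) UF; first by exists m.
      by apply: IH; apply: filterS (filterI FU FC) => x [[//|Cx] nCx].
    case=> k FC; exists (q k); apply: filterS FC => x.
    move=> /(_ (ball x (n.+1%:R^-1 : R))) [|y [qy xy]].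
      by apply: nbhsx_ballx; rewrite invr_gt0.
    apply: (@le_ball _ _ _ (n.+1%:R^-1 + n.+1%:R^-1 : R)); first by rewrite (splitr r) lerD// ltW.
    by apply: ball_triangle qy _; exact: ball_sym.
  have PF : ProperFilter F by exact: ultra_proper.
  have cvF := @cauchy_cvg _ F PF cF.
  exists (lim F); split => //.
  exact: (@closed_cvg _ _ F PF id K cK FK _ cvF).
apply: (@le_trans _ _ (mu (\bigcup_n (phi @^-1` (~` U n (N n)))))).
  apply: le_measure; rewrite ?inE.
  - by apply: open_phi; exact: closed_openC.
  - by apply: bigcup_measurable => n _; apply: open_phi; exact: closed_openC.
  - by rewrite -preimage_bigcup; apply: preimage_subset; rewrite /K setC_bigcap.
apply: le_trans (@measure_sigma_subadditive _ _ _ mu _ (fun n => phi @^-1` (~` U n (N n))) _ _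
  (@subset_refl _ _)) _.
- by move=> k; apply: open_phi; exact: closed_openC.
- by apply: bigcup_measurable => n _; apply: open_phi; exact: closed_openC.
apply: le_trans (epsilon_trick0 xpredT (ltW e0)).
by apply: lee_nneseries => // i _; exact: UN.
Qed.

End regularity.

(** The completeness and separability of the Polish model enter the sequel only through the
    approximation by compact and open sets. *)
Lemma standard_borel_regular (R : realType) d (X : measurableType d) :
  standard_borel R X -> exists (P : ptopologicalType) (phi : X -> P),
  [/\ (forall V : set P, open V -> measurable (phi @^-1` V)) /\ set_surj setT setT phi,
      forall K : set P, compact K -> closed K,
      forall (mu : probability X R) A (e : R), measurable A -> 0 < e ->
        exists V : set P, [/\ open V, A `<=` phi @^-1` V &
          (mu (phi @^-1` V `\` A) <= e%:E)%E] &
      forall (mu : probability X R) A (e : R), measurable A -> 0 < e ->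
        exists K : set P, [/\ compact K, phi @^-1` K `<=` A &
          (mu (A `\` phi @^-1` K) <= e%:E)%E]].
Proof.
move=> [P [phi [hP sP [psi phiK psiK] bP]]]; exists P, phi.
have mphi B : <<s @open P >> B -> measurable (phi @^-1` B) by move=> /bP.
have op V : open V -> measurable (phi @^-1` V).
  by move=> oV; apply: mphi; exact: sub_sigma_algebra.
have cl F : closed F -> measurable (phi @^-1` F).
  by move=> /closed_openC/op/measurableC; rewrite -preimage_setC setCK.
have reg (mu : probability X R) A : measurable A -> regular_for mu phi (psi @^-1` A).
  move=> mA; apply: borel_regular => //.
  by apply/bP; rewrite -comp_preimage (_ : psi \o phi = id)//; apply/funext => x /=.
split.
- by split=> // p _; exists (psi p).
- by move=> K; exact: compact_closed.
- move=> mu A e mA e0; have [F [V [cF oV FA AV FVe]]] := reg mu A mA e e0.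
  exists V; split => //; first by move=> x Ax; apply: AV; rewrite /= phiK.
  apply: le_trans FVe; apply: le_measure; rewrite ?inE.
  + by apply: measurableD => //; exact: op.
  + by apply: (@measurableD _ _ (phi @^-1` V) (phi @^-1` F)); [exact: op|exact: cl].
  + by move=> x [Vx nAx]; split => // /FA /=; rewrite phiK.
- move=> mu A e mA e0; have e2 : 0 < e / 2 by rewrite divr_gt0.
  have [F [V [cF oV FA AV FVe]]] := reg mu A mA _ e2.
  have [K [cK kK Ke]] := tight_measure mu mphi sP e2.
  exists (F `&` K); split.
  + by rewrite setIC; apply: compact_closedI.
  + by move=> x [/FA]; rewrite /= phiK.
  rewrite (splitr e) EFinD; apply: le_trans (leeD FVe Ke).
  apply: le_trans (measureU2 _ _ _); last 2 first.
  + by apply: measurableD; [exact: op|exact: cl].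
  + by apply/op/closed_openC.
  apply: le_measure; rewrite ?inE.
  + by apply: measurableD => //; apply: cl; exact: closedI.
  + apply: measurableU; first by apply: measurableD; [exact: op|exact: cl].
    exact/op/closed_openC.
  + move=> x [Ax nFK]; have [Fx|nFx] := pselect (F (phi x)).
      by right => Kx; apply: nFK.
    by left; split => //; apply: AV; rewrite /= phiK.
Qed.

(** * Measures from biadditive functions of two sets *)

Section finite_additivity.
Context (T : Type) (R : zmodType) (G : set (set T)) (f : set T -> R).
Hypotheses (G0 : G set0) (GU : forall A B, G A -> G B -> G (A `|` B)).
Hypotheses (f0 : f set0 = 0)
  (fU : forall A B, G A -> G B -> A `&` B = set0 -> f (A `|` B) = f A + f B).

Lemma fin_additive_seq (J : eqType) (r : seq J) (P : pred J) (F : J -> set T) :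
  uniq r -> (forall j, G (F j)) ->
  (forall i j, P i -> P j -> i != j -> F i `&` F j = set0) ->
  f (\big[setU/set0]_(j <- r | P j) F j) = \sum_(j <- r | P j) f (F j).
Proof.
move=> + GF tF; elim: r => [|a r IH]; first by rewrite !big_nil.
rewrite /= !big_cons => /andP[ar /IH{}IH]; case: ifPn => // Pa.
rewrite fU ?IH//; first by apply: big_ind.
rewrite big_distrr/=; apply: big1_seq => j /andP[Pj jr].
by apply: tF => //; apply: contraNneq ar => ->.
Qed.

Lemma fin_additive (J : finType) (P : pred J) (F : J -> set T) (C : set T) :
  (forall j, G (F j)) ->
  (forall i j, P i -> P j -> i != j -> F i `&` F j = set0) ->
  (forall x, C x <-> exists2 j, P j & F j x) ->
  f C = \sum_(j | P j) f (F j).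
Proof.
move=> GF tF CE; rewrite -fin_additive_seq ?index_enum_uniq//.
rewrite -bigcup_seq_cond; congr f; apply/seteqP; split=> [x /CE[j Pj Fj]|x [j /= /andP[_ Pj] Fj]].
  by exists j; rewrite //= mem_index_enum.
by apply/CE; exists j.
Qed.

End finite_additivity.

(** The product type already carries the product sigma-algebra; this copy of it carries the
    semiring of measurable rectangles. *)
Definition rect (X Y : Type) : Type := (X * Y)%type.

Section rectangles.
Context d1 d2 (X : measurableType d1) (Y : measurableType d2).

Definition is_rect (C : set (rect X Y)) := exists A B,
  [/\ measurable A, measurable B & C = (A : set X) `*` (B : set Y)].

Let is_rect0 : is_rect set0.
Proof. by exists set0, set0; split => //; rewrite set0X. Qed.

Let is_rectI : setI_closed is_rect.
Proof.
move=> _ _ [A [B [mA mB ->]]] [A' [B' [mA' mB' ->]]].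
by exists (A `&` A'), (B `&` B'); split; [exact: measurableI|exact: measurableI|rewrite setXI].
Qed.

Let is_rectD : semi_setD_closed is_rect.
Proof.
move=> _ _ [A [B [mA mB ->]]] [A' [B' [mA' mB' ->]]].
exists [set (A `\` A') `*` B; (A `&` A') `*` (B `\` B')]; split.
- exact: finite_set2.
- move=> _ [->|->].
  + by exists (A `\` A'), B; split => //; exact: measurableD.
  + by exists (A `&` A'), (B `\` B'); split => //; [exact: measurableI|exact: measurableD].
- apply/seteqP; split => [[x y] [[/= Ax By] nAB]|[x y] [_ [->|->]]].
  + have [A'x|nA'x] := pselect (A' x).
      by exists ((A `&` A') `*` (B `\` B')); [right|split => //; split => // B'y; apply: nAB].
    by exists ((A `\` A') `*` B); [left|].
  + by move=> [[/= Ax nAx] By]; split => // -[].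
  + by move=> [[/= Ax nAx] [By nBy]]; split => // -[].
- move=> _ _ [->|->] [->|->] // [[x y]].
    by move=> [[[/= _ nA'x] _] [[_ A'x] _]].
  by move=> [[[/= _ nA'x] _] [[_ A'x] _]].
Qed.

HB.instance Definition _ := Pointed.on (rect X Y).
HB.instance Definition _ := @isSemiRingOfSets.Build default_measure_display (rect X Y)
  is_rect is_rect0 is_rectI is_rectD.

End rectangles.

(** A coupling seen through its values on rectangles. All these conditions are equalities or
    weak inequalities between finitely many coordinates of [m], so they are closed for the
    product topology; the range condition is asked of all pairs of sets, measurable or not,
    so that the set of these functions is contained in a product of segments. *)
Definition precoupling (R : realType) d1 d2 (X : measurableType d1) (Y : measurableType d2)
  (mu : probability X R) (nu : probability Y R) (m : set X * set Y -> R) : Prop :=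
  [/\ forall p, 0 <= m p <= 1,
      forall A A' B, measurable A -> measurable A' -> measurable B ->
        A `&` A' = set0 -> m (A `|` A', B) = m (A, B) + m (A', B),
      forall A B B', measurable A -> measurable B -> measurable B' ->
        B `&` B' = set0 -> m (A, B `|` B') = m (A, B) + m (A, B'),
      forall A, measurable A -> (m (A, setT))%:E = mu A &
      forall B, measurable B -> (m (setT, B))%:E = nu B].

Section coupling.
Context (R : realType) d1 d2 (X : measurableType d1) (Y : measurableType d2).
Context (mu : probability X R) (nu : probability Y R) (m : set X * set Y -> R).
Hypothesis Hm : precoupling mu nu m.
Hypotheses (sX : standard_borel R X) (sY : standard_borel R Y).

Let m_ge0 p : 0 <= m p. Proof. by have [/(_ p)/andP[]] := Hm. Qed.
Let mUl A A' B : measurable A -> measurable A' -> measurable B ->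
  A `&` A' = set0 -> m (A `|` A', B) = m (A, B) + m (A', B).
Proof. by have [_ + _ _ _] := Hm; apply. Qed.
Let mUr A B B' : measurable A -> measurable B -> measurable B' ->
  B `&` B' = set0 -> m (A, B `|` B') = m (A, B) + m (A, B').
Proof. by have [_ _ + _ _] := Hm; apply. Qed.
Let m_mu A : measurable A -> (m (A, setT))%:E = mu A.
Proof. by have [_ _ _ + _] := Hm; apply. Qed.
Let m_nu B : measurable B -> (m (setT, B))%:E = nu B.
Proof. by have [_ _ _ _ +] := Hm; apply. Qed.

Lemma precoupling0l B : measurable B -> m (set0, B) = 0.
Proof.
move=> mB; have := @mUl set0 set0 B measurable0 measurable0 mB (setI0 _).
by rewrite setU0 => /eqP; rewrite addrC -subr_eq subrr => /eqP.
Qed.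

Lemma precoupling0r A : measurable A -> m (A, set0) = 0.
Proof.
move=> mA; have := @mUr A set0 set0 mA measurable0 measurable0 (setI0 _).
by rewrite setU0 => /eqP; rewrite addrC -subr_eq subrr => /eqP.
Qed.

Lemma precouplingDl A A' B : measurable A -> measurable A' -> measurable B ->
  A `<=` A' -> m (A', B) = m (A, B) + m (A' `\` A, B).
Proof.
move=> mA mA' mB AA'; rewrite -mUl ?setDUK//; first exact: measurableD.
by rewrite setDE setICA setICr setI0.
Qed.

Lemma precouplingDr A B B' : measurable A -> measurable B -> measurable B' ->
  B `<=` B' -> m (A, B') = m (A, B) + m (A, B' `\` B).
Proof.
move=> mA mB mB' BB'; rewrite -mUr ?setDUK//; first exact: measurableD.
by rewrite setDE setICA setICr setI0.
Qed.

Lemma precoupling_le A A' B B' : measurable A -> measurable A' -> measurable B -> measurable B' ->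
  A `<=` A' -> B `<=` B' -> m (A, B) <= m (A', B').
Proof.
move=> mA mA' mB mB' AA' BB'; rewrite (precouplingDl mA mA' mB' AA') (precouplingDr mA mB mB' BB').
by rewrite -addrA lerDl addr_ge0.
Qed.

(** Enlarging the sides of a rectangle costs at most the marginal masses of what is added;
    with this, regularity of the marginals is all that countable additivity of [m] needs. *)
Lemma precoupling_gap A A' B B' : measurable A -> measurable A' -> measurable B -> measurable B' ->
  A `<=` A' -> B `<=` B' ->
  ((m (A', B'))%:E <= (m (A, B))%:E + mu (A' `\` A) + nu (B' `\` B))%E.
Proof.
move=> mA mA' mB mB' AA' BB'; rewrite (precouplingDl mA mA' mB' AA') (precouplingDr mA mB mB' BB').
have mDA := measurableD mA' mA; have mDB := measurableD mB' mB.
rewrite -m_mu// -m_nu// -!EFinD lee_fin -!addrA lerD2l addrC.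
by apply: lerD; exact: precoupling_le.
Qed.

Lemma fst_rect (A : set X) (B : set Y) : B !=set0 -> (A `*` B).`1 = A.
Proof.
by move=> [b Bb]; apply/seteqP; split => [x [y []]//|x Ax]; exists b.
Qed.

Lemma snd_rect (A : set X) (B : set Y) : A !=set0 -> (A `*` B).`2 = B.
Proof.
by move=> [a Aa]; apply/seteqP; split => [y [x []]//|y By]; exists a.
Qed.

Lemma fst_set0 : (set0 : set (X * Y)).`1 = set0.
Proof. by rewrite -subset0 => x [y]. Qed.

Lemma snd_set0 : (set0 : set (X * Y)).`2 = set0.
Proof. by rewrite -subset0 => y [x]. Qed.

Lemma is_rect_proj (C : set (rect X Y)) : measurable C ->
  [/\ measurable (C.`1 : set X), measurable (C.`2 : set Y) & C = C.`1 `*` C.`2].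
Proof.
move=> [A [B [mA mB ->]]].
have [->|/set0P B0] := eqVneq B set0.
  by rewrite setX0 fst_set0 snd_set0 setX0.
have [->|/set0P A0] := eqVneq A set0.
  by rewrite set0X fst_set0 snd_set0 setX0.
by rewrite fst_rect// snd_rect.
Qed.

(** The content of a rectangle is computed from its two projections, which recover the sides
    when the rectangle is not empty. The proofs among the arguments let the measure
    structures declared below be found from the term alone. *)
Definition rect_content (_ : precoupling mu nu m) (_ : standard_borel R X)
  (_ : standard_borel R Y) (C : set (rect X Y)) : \bar R := (m (C.`1, C.`2))%:E.
Local Notation content := (rect_content Hm sX sY).

Lemma rect_contentE (A : set X) (B : set Y) : measurable A -> measurable B ->
  content (A `*` B) = (m (A, B))%:E.
Proof.
move=> mA mB; rewrite /rect_content.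
have [->|/set0P B0] := eqVneq B set0.
  by rewrite setX0 fst_set0 snd_set0 !precoupling0r.
have [->|/set0P A0] := eqVneq A set0.
  by rewrite set0X fst_set0 snd_set0 !precoupling0l.
by rewrite fst_rect// snd_rect.
Qed.

Let rect_content_ge0 C : (0 <= content C)%E.
Proof. by rewrite lee_fin. Qed.

Let rect_content_additive : measure_function.semi_additive content.
Proof.
move=> F n mF tF mUF.
pose A i := (F i).`1; pose B i := (F i).`2.
have mA i : measurable (A i) by have [] := is_rect_proj (mF i).
have mB i : measurable (B i) by have [] := is_rect_proj (mF i).
have FE i : F i = A i `*` B i by have [] := is_rect_proj (mF i).
set U := \big[setU/set0]_(i < n) F i in mUF *.
have [mUA mUB UE] := is_rect_proj mUF.
pose UA := U.`1; pose UB := U.`2.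
have FU (i : 'I_n) : F i `<=` U.
  by rewrite /U -bigcup_mkord => x Fx; exists i => /=.
have AU (i : 'I_n) : A i `<=` UA by move=> x [y /FU Fxy]; exists y.
have BU (i : 'I_n) : B i `<=` UB by move=> x [y /FU Fxy]; exists y.
(* The [al J] are the atoms of the algebra generated by the left sides. *)
pose al (J : {set 'I_n}) := [set x | UA x /\ forall i : 'I_n, A i x <-> i \in J].
have mal J : measurable (al J).
  rewrite (_ : al J = UA `&` \bigcap_(i in [set: 'I_n]) (if i \in J then A i else ~` A i)).
    apply: measurableI => //; apply: fin_bigcap_measurable => //.
    by move=> i _; case: ifPn => // _; exact: measurableC.
  apply/seteqP; split => x [UAx H]; split => //.
    by move=> i _; case: ifPn => [/H|/negP nJ /H].
  move=> i; have := H i I; case: ifPn => // _ nA; split => //.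
have tal J J' : J != J' -> al J `&` al J' = set0.
  move=> JJ'; rewrite -subset0 => x [[_ H] [_ H']].
  by move/eqP: JJ'; apply; apply/setP => i; apply/idP/idP => [/H/H'|/H'/H].
have split_al (P : pred {set 'I_n}) (C : set X) D : measurable D ->
    (forall x, C x <-> exists2 J, P J & al J x) ->
    m (C, D) = \sum_(J | P J) m (al J, D).
  move=> mD CE; apply: (fin_additive (G := measurable) (f := fun C => m (C, D))) CE => //.
  - exact: measurableU.
  - exact: precoupling0l.
  - by move=> *; exact: mUl.
  - by move=> J J' _ _; exact: tal.
have alx x : UA x -> al [set i : 'I_n | `[< A i x >]]%SET x.
  move=> UAx; split => // i; rewrite inE.
  by split => [Aix|/asboolP//]; apply/asboolP.
rewrite /rect_content -/UA -/UB (split_al predT)//; last first.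
  by move=> x; split => [/alx ax|[J _ []]//]; eexists; last exact: ax.
have -> : (\sum_(i < n) (m ((F i).`1, (F i).`2))%:E = (\sum_(i < n) m (A i, B i))%:E)%E.
  by rewrite sumEFin.
congr EFin.
transitivity (\sum_(i < n) \sum_(J : {set 'I_n} | i \in J) m (al J, B i)); last first.
  apply: eq_bigr => i _; rewrite -(split_al (fun J : {set 'I_n} => i \in J) (A i))// => x; split.
    move=> Aix; have UAx := AU i x Aix; exists [set i : 'I_n | `[< A i x >]]%SET; last exact: alx.
    by rewrite inE; apply/asboolP.
  by move=> [J iJ [_ H]]; apply/H.
rewrite [RHS](exchange_big_dep predT)//=.
apply: eq_bigr => J _.
have [->|/set0P[x [UAx xJ]]] := eqVneq (al J) set0.
  by rewrite precoupling0l// big1// => i _; rewrite precoupling0l.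
apply: (fin_additive (G := measurable) (f := fun D => m (al J, D))) => //.
- exact: measurableU.
- exact: precoupling0r.
- by move=> *; exact: mUr.
- move=> i j /xJ Aix /xJ Ajx ij; rewrite -subset0 => y [Biy Bjy].
  have := tF i j I I; rewrite FE [F j]FE => /(_ _)/eqP.
  move=> H; move/negP: ij; apply; apply: H; by exists (x, y).
- move=> y; split => [UBy|[i _ /BU]//].
  have : U (x, y) by rewrite UE.
  rewrite /U -bigcup_mkord => -[i/= ilt Fxy].
  by exists (Ordinal ilt); [apply/xJ; exists y|exists x].
Qed.

HB.instance Definition _ := isContent.Build _ (rect X Y) R content
  rect_content_ge0 rect_content_additive.

(** The rectangles of the cover are enlarged to open ones and the covered rectangle is shrunk
    to a compact one, which reduces the inequality to finite subadditivity. *)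
Let rect_content_sigma : measurable_subset_sigma_subadditive content.
Proof.
move=> C F mF mC CF.
have [P [phi [[oP sP] cP outP inP]]] := standard_borel_regular sX.
have [Q [psi [[oQ sQ] cQ outQ inQ]]] := standard_borel_regular sY.
pose A i := (F i).`1; pose B i := (F i).`2.
have mA i : measurable (A i) by have [] := is_rect_proj (mF i).
have mB i : measurable (B i) by have [] := is_rect_proj (mF i).
have FE i : F i = A i `*` B i by have [] := is_rect_proj (mF i).
have [mCA mCB CE] := is_rect_proj mC.
have closed_phi K : compact K -> measurable (phi @^-1` K).
  by move=> /cP/closed_openC/oP/measurableC; rewrite -preimage_setC setCK.
have closed_psi K : compact K -> measurable (psi @^-1` K).
  by move=> /cQ/closed_openC/oQ/measurableC; rewrite -preimage_setC setCK.
apply/lee_addgt0Pr => e e0.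
have e4 : 0 < e / 4 by rewrite divr_gt0.
have e2 : 0 < e / 2 by rewrite divr_gt0.
have en (n : nat) : 0 < e / 2 / (2 ^ n.+1)%:R / 2 by rewrite !divr_gt0// ltr0n expn_gt0.
have [K [cK KA Ke]] := inP mu _ _ mCA e4.
have [L [cL LB Le]] := inQ nu _ _ mCB e4.
have /choice[U UP] n := outP mu _ _ (mA n) (en n).
have /choice[V VP] n := outQ nu _ _ (mB n) (en n).
have [N KLN] : exists N, phi @^-1` K `*` psi @^-1` L `<=`
    \big[setU/set0]_(n < N) (phi @^-1` U n `*` psi @^-1` V n).
  have /compact_near_coveringP/(_ nat \oo (fun N x => exists2 n, (n < N)%N &
    (U n `*` V n) x) _) := compact_setX cK cL.
  case=> [[p q] [/= Kp Lq]|N _ /(_ N (leqnn N)) KLN]; last first.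
    exists N => -[x y] [Kx Ly].
    have [n nN Unxy] := KLN (phi x, psi y) (conj Kx Ly).
    by rewrite -(bigcup_mkord N (fun n => phi @^-1` U n `*` psi @^-1` V n)); exists n.
  have [x _ xp] := sP p I; have [y _ yq] := sQ q I; subst p q.
  have [|n _] := CF (x, y); first by rewrite CE; split; [exact: KA|exact: LB].
  rewrite FE => -[/= Ax By].
  have [oU AU _] := UP n; have [oV BV _] := VP n.
  exists (U n `*` V n, [set N | (n < N)%N]).
    split; last by exists n.+1.
    exists (U n, V n) => //; split; apply: open_nbhs_nbhs; split => //; [exact: AU|exact: BV].
  by move=> [z N] [/= Uz nN]; exists n.
have mU n : measurable (phi @^-1` U n) by apply: oP; have [] := UP n.
have mV n : measurable (psi @^-1` V n) by apply: oQ; have [] := VP n.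
have mK := closed_phi K cK; have mL := closed_psi L cL.
have KLle : (content (phi @^-1` K `*` psi @^-1` L) <=
    \sum_(n < N) content (phi @^-1` U n `*` psi @^-1` V n))%E.
  apply: (@content_subadditive _ _ _ [the {content set (rect X Y) -> \bar R} of content]
    (phi @^-1` K `*` psi @^-1` L) (fun n => phi @^-1` U n `*` psi @^-1` V n)) => //.
  - by move=> k _; exists (phi @^-1` U k), (psi @^-1` V k).
  - by exists (phi @^-1` K), (psi @^-1` L).
rewrite CE rect_contentE//.
apply: le_trans (precoupling_gap mK mCA mL mCB KA LB) _.
rewrite -(rect_contentE mK mL).
apply: (@le_trans _ _ (content (phi @^-1` K `*` psi @^-1` L) + (e / 2)%:E)%E).
  rewrite (_ : e / 2 = e / 4 + e / 4); last by field.
  by rewrite EFinD addeA; apply: leeD => //; apply: leeD.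
rewrite [in leRHS](splitr e) EFinD addeA; apply: leeD => //.
apply: le_trans (epsilon_trick xpredT _ (ltW e2)); last by move=> n; exact: rect_content_ge0.
apply: (le_trans KLle).
apply: (@le_trans _ _ (\sum_(0 <= n < N) (content (F n) + (e / 2 / (2 ^ n.+1)%:R)%:E))%E);
  last first.
  apply: nneseries_lim_ge => n _ _; apply: adde_ge0; first exact: rect_content_ge0.
  by rewrite lee_fin ltW// divr_gt0// ltr0n expn_gt0.
rewrite big_mkord; apply: lee_sum => n _; rewrite [in leRHS]FE !rect_contentE//.
have [_ AU Ue] := UP n; have [_ BV Ve] := VP n.
apply: le_trans (precoupling_gap (mA n) (mU n) (mB n) (mV n) AU BV) _.
rewrite -addeA leeD2l// [in leRHS](splitr (e / 2 / _)) EFinD.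
exact: leeD.
Qed.

HB.instance Definition _ := Content_SigmaSubAdditive_isMeasure.Build _ R (rect X Y)
  content rect_content_sigma.

Definition coupling_measure (_ : precoupling mu nu m) (_ : standard_borel R X)
  (_ : standard_borel R Y) (C : set (X * Y)) : \bar R :=
  measure_extension [the {measure set (rect X Y) -> \bar R} of content] C.
Local Notation lam := (coupling_measure Hm sX sY).

Let measurable_rect_ext (C : set (X * Y)) : measurable C ->
  <<s @measurable _ (rect X Y) >> C.
Proof.
rewrite measurable_prod_measurableType; apply: sub_smallest2r => //.
by move=> _ [A mA [B mB <-]]; exists A, B.
Qed.

Let lam0 : lam set0 = 0%E. Proof. exact: measure0. Qed.
Let lam_ge0 C : (0 <= lam C)%E. Proof. exact: measure_ge0. Qed.
Let lam_sigma : semi_sigma_additive lam.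
Proof.
move=> F mF tF mUF.
by apply: (@measure_semi_sigma_additive _ _ _ (measure_extension [the {measure set
  (rect X Y) -> \bar R} of content])) => // [i|]; exact: measurable_rect_ext.
Qed.
HB.instance Definition _ := isMeasure.Build _ _ _ lam lam0 lam_ge0 lam_sigma.

Lemma coupling_measureE A B : measurable A -> measurable B ->
  lam (A `*` B) = (m (A, B))%:E.
Proof.
move=> mA mB; rewrite /coupling_measure /measure_extension measurable_mu_extE/=.
  by rewrite rect_contentE.
by exists A, B.
Qed.

Let lamT : lam setT = 1%E.
Proof. by rewrite -setXTT coupling_measureE// m_mu// probability_setT. Qed.
HB.instance Definition _ := Measure_isProbability.Build _ _ _ lam lamT.

(** Caratheodory's extension of the content. Outside standard Borel spaces a biadditive
    function with sigma-additive marginals need not be countably additive. *)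
Lemma coupling_of_precoupling : exists lam' : probability (X * Y)%type R,
  forall A B, measurable A -> measurable B -> lam' (A `*` B) = (m (A, B))%:E.
Proof. by exists [the probability _ _ of lam] => A B; exact: coupling_measureE. Qed.

End coupling.

(** * Products of standard Borel spaces *)

(* Records on products the joins of structures that the product instances support, in
   particular the pointed pseudometric structure which completeness extends. *)
HB.saturate prod.
Section prod_complete.
Context (R : realType) (P Q : completePseudoMetricType R).

Lemma prod_cauchy_cvg (F : set_system (P * Q)) : ProperFilter F -> cauchy F -> cvg F.
Proof.
move=> FF /cauchyP cF.
have c1 : cvg (fst @ F).
  apply: cauchy_cvg; apply: cauchy_exP => e e0; have [x Fx] := cF e e0.
  by exists x.1; apply: (@filterS _ F _ _ _ _ Fx) => y [].
have c2 : cvg (snd @ F).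
  apply: cauchy_cvg; apply: cauchy_exP => e e0; have [x Fx] := cF e e0.
  by exists x.2; apply: (@filterS _ F _ _ _ _ Fx) => y [].
apply/cvg_ex; exists (lim (fst @ F), lim (snd @ F)).
have := @cvg_pair _ _ _ _ _ _ _ _ _ _ _ c1 c2.
rewrite (_ : (fun x : P * Q => (x.1, x.2)) = id); first exact.
by apply/funext => -[].
Qed.

HB.instance Definition _ := Uniform_isComplete.Build (P * Q)%type prod_cauchy_cvg.

End prod_complete.

Section standard_borel_lemmas.
Context (R : realType).

(** Both directions of the Borel isomorphism as measurable functions, so that they can be
    composed. *)
Lemma standard_borelP d (X : measurableType d) :
  standard_borel R X <-> exists (P : completePseudoMetricType R) (phi : X -> P) (psi : P -> X),
   [/\ hausdorff_space P, exists q : nat -> P, dense (range q),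
     cancel phi psi /\ cancel psi phi,
     measurable_fun setT (phi : X -> g_sigma_algebraType (@open P)) &
     measurable_fun setT (psi : g_sigma_algebraType (@open P) -> X)].
Proof.
split.
- move=> [P [phi [hP [D cD dD] [psi phiK psiK] bP]]]; exists P, phi, psi; split => //.
  + move/pcard_surjP : cD => [q Dq]; exists q.
    move=> O O0 oO; have [x [Ox Dx]] := dD O O0 oO; exists x; split => //.
    by have [n _ <-] := Dq x Dx; exists n.
  + by move=> _ B mB; rewrite setTI; apply/bP.
  + move=> _ A mA; rewrite setTI; apply/bP.
    by rewrite -comp_preimage (_ : psi \o phi = id)//; apply/funext => x /=.
- move=> [P [phi [psi [hP [q dq] [phiK psiK] mphi mpsi]]]]; exists P, phi; split => //.
  + by exists (range q) => //; apply: card_image_le.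
  + by exists psi.
  + move=> A; split => [mA|mA]; last by rewrite -[X in measurable X]setTI; exact: mphi.
    have := mpsi measurableT _ mA.
    by rewrite setTI -comp_preimage (_ : phi \o psi = id)//; apply/funext => x /=.
Qed.

Lemma standard_borel_iso d (X : measurableType d) d' (X' : measurableType d')
  (f : X -> X') (g : X' -> X) : cancel f g -> cancel g f ->
  measurable_fun setT f -> measurable_fun setT g ->
  standard_borel R X -> standard_borel R X'.
Proof.
move=> fK gK mf mg /standard_borelP[P [phi [psi [hP sP [phiK psiK] mphi mpsi]]]].
apply/standard_borelP; exists P, (phi \o g), (f \o psi); split => //.
- by split=> x /=; rewrite ?phiK ?gK// fK psiK.
- exact: measurableT_comp mphi mg.
- exact: measurableT_comp mf mpsi.
Qed.

Lemma hausdorff_prod (P Q : topologicalType) :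
  hausdorff_space P -> hausdorff_space Q -> hausdorff_space (P * Q)%type.
Proof.
move=> hP hQ [a b] [c d] H; congr pair.
- apply: hP => A B nA nB.
  have [] := H (A `*` setT) (B `*` setT).
  + by exists (A, setT) => //; split => //; exact: filterT.
  + by exists (B, setT) => //; split => //; exact: filterT.
  + by move=> [x y] [[/= Ax _] [Bx _]]; exists x.
- apply: hQ => A B nA nB.
  have [] := H (setT `*` A) (setT `*` B).
  + by exists (setT, A) => //; split => //; exact: filterT.
  + by exists (setT, B) => //; split => //; exact: filterT.
  + by move=> [x y] [[/= _ Ay] [_ By]]; exists y.
Qed.

Lemma continuous_borel (P Q : ptopologicalType) (f : P -> Q) : continuous f ->
  measurable_fun setT (f : g_sigma_algebraType (@open P) -> g_sigma_algebraType (@open Q)).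
Proof.
move=> cf; apply: (@measurability _ _ _ (g_sigma_algebraType (@open Q)) _ _ (@open Q) erefl) => //.
move=> _ [W oO <-]; rewrite setTI; apply: sub_sigma_algebra.
by move/continuousP : cf; exact.
Qed.

(** Separability makes every open set of the product a countable union of open rectangles,
    so the Borel sigma-algebra of the product is the product of the Borel sigma-algebras. *)
Lemma standard_borel_prod d1 d2 (X : measurableType d1) (Y : measurableType d2) :
  standard_borel R X -> standard_borel R Y -> standard_borel R (X * Y)%type.
Proof.
move=> /standard_borelP[P [phi [psi [hP [p dp] [phiK psiK] mphi mpsi]]]].
move=> /standard_borelP[Q [phi' [psi' [hQ [q dq] [phi'K psi'K] mphi' mpsi']]]].
apply/standard_borelP; exists (P * Q)%type, (fun z => (phi z.1, phi' z.2)), (fun z =>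
  (psi z.1, psi' z.2)).
(* The interiors of the balls of radius [1 / n] around a dense sequence form a base. *)
have cball (S : completePseudoMetricType R) (s : nat -> S) : dense (range s) ->
    forall (O : set S) x, nbhs x O -> exists i n, 
      (ball (s i) (n.+1%:R^-1 : R))° x /\ (ball (s i) (n.+1%:R^-1 : R))° `<=` O.
  move=> ds O x /nbhs_ballP[r /= r0 rO].
  have [|n nr] := @small_inv _ (r / 2); first by rewrite divr_gt0.
  have n0 : 0 < (n.+2%:R^-1 : R) / 2 by rewrite divr_gt0// invr_gt0.
  have [||y [xy [i _ iy]]] := ds (ball x (n.+2%:R^-1 / 2 : R))°.
  - by exists x; apply: nbhs_singleton; apply: nbhs_interior; exact: nbhsx_ballx.
  - exact: open_interior.
  have {}xy := interior_subset xy.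
  exists i, n.+1; split.
    apply/nbhs_ballP; exists (n.+2%:R^-1 / 2 : R) => //= z xz.
    rewrite (splitr (n.+2%:R^-1)); apply: ball_triangle _ xz.
    by rewrite iy; apply: ball_sym.
  move=> z /interior_subset sz; apply: rO.
  rewrite (splitr r); apply: ball_triangle.
    apply: (@le_ball _ _ _ (n.+2%:R^-1 / 2 : R)); last exact: xy.
    apply: (le_trans _ (ltW nr)); rewrite ler_pdivrMr// (@le_trans _ _ (n.+1%:R^-1))//.
      by rewrite lef_pV2 ?posrE// ler_nat.
    by rewrite ler_pMr ?invr_gt0// ler1n.
  rewrite -iy; apply: le_ball sz; apply: (le_trans _ (ltW nr)).
  by rewrite lef_pV2 ?posrE// ler_nat.
split.
- exact: hausdorff_prod.
- exists (fun n => if choice.unpickle n is Some (i, j) then (p i, q j) else (p 0%N, q 0%N)).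
  move=> O [[x y] Oxy] oO.
  have [[U V] /= [Ux Vy] UVO] := open_nbhs_nbhs (conj oO Oxy).
  have [i [n [_ iU]]] := cball _ _ dp U x Ux.
  have [j [m [_ jV]]] := cball _ _ dq V y Vy.
  exists (p i, q j); split; last by exists (choice.pickle (i, j)) => //; rewrite choice.pickleK.
  by apply: UVO; split => /=; [apply: iU|apply: jV]; apply: nbhs_singleton;
    apply: nbhs_interior; exact: nbhsx_ballx.
- by split => -[x y] /=; rewrite ?phiK ?phi'K ?psiK ?psi'K.
- apply: (@measurability _ _ _ (g_sigma_algebraType (@open (P * Q)%type)) _ _ (@open
  (P * Q)%type) erefl) => //.
  move=> _ [W oO <-]; rewrite setTI.
  pose B i n := (ball (p i) (n.+1%:R^-1 : R))°; pose B' i n := (ball (q i) (n.+1%:R^-1 : R))°.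
  rewrite (_ : _ @^-1` W = \bigcup_(k : (nat * nat) * (nat * nat))
     (if `[< B k.1.1 k.1.2 `*` B' k.2.1 k.2.2 `<=` W >] then
      (phi @^-1` B k.1.1 k.1.2) `*` (phi' @^-1` B' k.2.1 k.2.2) else set0)).
    apply: countable_bigcupT_measurable => // k; case: ifPn => // _.
    apply: measurableX; rewrite -[X in measurable X]setTI.
      by apply: mphi => //; apply: sub_sigma_algebra; exact: open_interior.
    by apply: mphi' => //; apply: sub_sigma_algebra; exact: open_interior.
  apply/seteqP; split => [[x y]/= Oxy|[x y] [k _]].
    have [[U V] /= [Ux Vy] UVO] := open_nbhs_nbhs (conj oO Oxy : open_nbhs (phi x, phi' y) W).
    have [i [n [ix iU]]] := cball _ _ dp U _ Ux.
    have [j [m [jy jV]]] := cball _ _ dq V _ Vy.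
    exists ((i, n), (j, m)) => //=; case: ifPn => // /asboolP; apply.
    by move=> [a b] [/iU Ua /jV Vb]; apply: UVO.
  case: ifPn => // /asboolP kO [/= Bx By]; exact: (kO (_, _)).
- apply/measurable_fun_pairP; split.
  + rewrite (_ : _ \o _ = psi \o fst)//; apply: measurableT_comp mpsi _.
    by apply: continuous_borel => x; exact: cvg_fst.
  + rewrite (_ : _ \o _ = psi' \o snd)//; apply: measurableT_comp mpsi' _.
    by apply: continuous_borel => x; exact: cvg_snd.
Qed.

Definition tuple_uncons d (Y : measurableType d) n (t : n.+1.-tuple Y) : Y * n.-tuple Y :=
  (thead t, [tuple of behead t]).

Lemma tuple_consK d (Y : measurableType d) n : cancel (@tuple_cons d Y n) (@tuple_uncons d Y n).
Proof. by case=> y t; congr pair; apply: val_inj. Qed.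

Lemma tuple_unconsK d (Y : measurableType d) n : cancel (@tuple_uncons d Y n) (@tuple_cons d Y n).
Proof. by move=> t; rewrite [RHS]tuple_eta; apply: val_inj. Qed.

Lemma measurable_tuple_uncons d (Y : measurableType d) n :
  measurable_fun setT (@tuple_uncons d Y n).
Proof.
apply: measurable_fun_pair; last exact: measurable_behead.
exact: measurable_tnth.
Qed.

Lemma standard_borel_tuple d (Y : measurableType d) n :
  standard_borel R Y -> standard_borel R (n.-tuple Y).
Proof.
move=> sY; elim: n => [|n IH].
  apply/standard_borelP; exists 'rV[R]_0, (fun=> 0), (fun=> [tuple]).
  have all0 (x y : 'rV[R]_0) : x = y by rewrite (thinmx0 x) (thinmx0 y).
  split.
  - by move=> x y _.
  - exists (fun=> 0) => O [x Ox] _; exists 0; split; last by exists 0%N.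
    by rewrite (all0 0 x).
  - by split=> x; [rewrite [RHS]tuple0|exact: all0].
  - exact: measurable_cst.
  - exact: measurable_cst.
apply: standard_borel_iso (@tuple_consK _ Y n) (@tuple_unconsK _ Y n) _ _ _.
- exact: measurable_tuple_cons.
- exact: measurable_tuple_uncons.
- exact: standard_borel_prod.
Qed.

End standard_borel_lemmas.

(** * Ergodicity and weak mixing of products *)

Lemma rect_measure_unique (R : realType) d1 d2 (X : measurableType d1) (Y : measurableType d2)
  (m1 m2 : {measure set (X * Y) -> \bar R}) : (m1 setT < +oo)%E ->
  (forall A B, measurable A -> measurable B -> m1 (A `*` B) = m2 (A `*` B)) ->
  forall C, measurable C -> m1 C = m2 C.
Proof.
move=> m1T m12 C mC.
apply: (measure_unique [set A `*` B | A in measurable & B in measurable] (fun=> setT)) => //.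
- by rewrite measurable_prod_measurableType.
- move=> _ _ [A mA [B mB <-]] [A' mA' [B' mB' <-]].
  by rewrite -setXI; exists (A `&` A'); [exact: measurableI|exists (B `&` B') => //;
    exact: measurableI].
- by move=> _; exists setT => //; exists setT => //; rewrite setXTT.
- by rewrite bigcup_const.
- by move=> _ [A mA [B mB <-]]; exact: m12.
Qed.

Section probability_facts.
Context (R : realType) d (X : measurableType d) (mu : probability X R).

Lemma probability_fineK A : measurable A -> (fine (mu A))%:E = mu A.
Proof. by move=> mA; rewrite fineK// fin_num_measure. Qed.

Lemma probability_fine01 A : measurable A -> 0 <= fine (mu A) <= 1.
Proof.
move=> mA; rewrite fine_ge0//=.
by rewrite -lee_fin probability_fineK// probability_le1.
Qed.

(** Equality in the Cauchy-Schwarz inequality: the square of [a - b] has integral [0]. *)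
Lemma ae_eq_of_moments (a b : X -> R) (s : R) :
  measurable_fun setT a -> measurable_fun setT b ->
  (forall x, 0 <= a x) -> (forall x, 0 <= b x) ->
  (\int[mu]_x (a x * b x)%:E = s%:E)%E -> (\int[mu]_x (a x * a x)%:E = s%:E)%E ->
  (\int[mu]_x (b x * b x)%:E = s%:E)%E -> {ae mu, forall x, a x = b x}.
Proof.
move=> ma mb a0 b0 ab aa bb.
have mM (f g : X -> R) : measurable_fun setT f -> measurable_fun setT g ->
    measurable_fun setT (EFin \o (fun x => f x * g x)).
  by move=> mf mg; apply/measurable_EFinP; exact: measurable_funM.
pose c x := a x - b x.
have mc : measurable_fun setT c by exact: measurable_funB.
have E : (\int[mu]_x (c x * c x)%:E + (\int[mu]_x (a x * b x)%:E + \int[mu]_x (a x * b x)%:E) =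
    \int[mu]_x (a x * a x)%:E + \int[mu]_x (b x * b x)%:E)%E.
  rewrite -!ge0_integralD//=; first last.
  all: try exact: mM; try by move=> x _; rewrite lee_fin mulr_ge0.
  - by apply: emeasurable_funD; exact: mM.
  - by move=> x _; rewrite -EFinD lee_fin addr_ge0// mulr_ge0.
  - by move=> x _; rewrite lee_fin -expr2 sqr_ge0.
  - apply: eq_integral => x _; rewrite -!EFinD; congr EFin; rewrite /c; ring.
rewrite ab aa bb in E.
have c0 : (\int[mu]_x `|(c x * c x)%:E| = 0)%E.
  under eq_integral do rewrite gee0_abs ?lee_fin -?expr2 ?sqr_ge0// expr2.
  move: E; have : (0 <= \int[mu]_x (c x * c x)%:E)%E.
    by apply: integral_ge0 => x _; rewrite lee_fin -expr2 sqr_ge0.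
  case: (\int[mu]_x (c x * c x)%:E)%E => [r|//|//]; rewrite -!EFinD => _ [] H.
  by congr EFin; lra.
have /ae_eq_integral_abs := c0; move=> /(_ measurableT (mM _ _ mc mc)).
apply: filterS => x /(_ I) /= [] /eqP; rewrite mulf_eq0 orbb subr_eq0 => /eqP.
by [].
Qed.

(** The constant is the infimum of the levels [t] at which the distribution function of [a]
    is [1]. *)
Lemma zero_one_const (a : X -> R) : measurable_fun setT a ->
  (forall x, 0 <= a x <= 1) ->
  (forall t, mu (a @^-1` `]-oo, t]) = 0%E \/ mu (a @^-1` `]-oo, t]) = 1%E) ->
  exists2 c, 0 <= c <= 1 & {ae mu, forall x, a x = c}.
Proof.
move=> ma a01 L01.
pose L t := a @^-1` `]-oo, t].
have mL t : measurable (L t) by rewrite -[L t]setTI; exact: ma.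
pose E := [set t | mu (L t) = 1%E].
have E1 : E 1.
  rewrite /E /= (_ : L 1 = setT) ?probability_setT//; apply/seteqP; split => // x _.
  by rewrite /L/= in_itv/=; have /andP[] := a01 x.
have E0 : lbound E 0.
  move=> t Et; rewrite leNgt; apply/negP => t0.
  have : mu (L t) = 0%E.
    rewrite (_ : L t = set0) ?measure0// -subset0 => x; rewrite /L/= in_itv/= => axt.
    by have /andP[a0 _] := a01 x; move: (le_lt_trans axt t0); rewrite ltNge a0.
  by rewrite Et => /eqP; rewrite onee_eq0.
have hE : has_inf E by split; [exists 1|exists 0].
pose c := inf E.
have c0 : 0 <= c by apply: lb_le_inf => //; exists 1.
have c1 : c <= 1 by apply: ge_inf => //; exists 0.
exists c; first by rewrite c0.
have mA n : mu (~` L (c + n.+1%:R^-1)) = 0%E.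
  have [t Et tc] : exists2 t, E t & t < c + n.+1%:R^-1 by apply: inf_adherent => //;
    rewrite invr_gt0.
  rewrite probability_setC//.
  case: (L01 (c + n.+1%:R^-1)) => [L0|->]; last by rewrite subee.
  have : (mu (L t) <= mu (L (c + n.+1%:R^-1)%R))%E.
    apply: le_measure; rewrite ?inE// => x; rewrite /L/= !in_itv/= => /le_trans; apply.
    exact: ltW.
  by rewrite L0 Et lee_fin ler10.
have mB n : mu (L (c - n.+1%:R^-1)) = 0%E.
  case: (L01 (c - n.+1%:R^-1)) => // L1.
  have : c <= c - n.+1%:R^-1 by apply: ge_inf => //; exists 0.
  by rewrite lerBrDr gerDl leNgt invr_gt0 ltr0n.
exists ((\bigcup_n ~` L (c + n.+1%:R^-1)) `|` (\bigcup_n L (c - n.+1%:R^-1))); split.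
- apply: measurableU; apply: bigcupT_measurable => n //; exact: measurableC.
- apply: null_set_setU.
  + by apply: bigcupT_measurable => n; exact: measurableC.
  + exact: bigcupT_measurable.
  + apply/eqP; rewrite -measure_le0; apply: le_trans (@measure_sigma_subadditive _ _ _ mu _
    (fun n => ~` L (c + n.+1%:R^-1)) _ _ (@subset_refl _ _)) _.
    * by move=> n; exact: measurableC.
    * by apply: bigcupT_measurable => n; exact: measurableC.
    * by rewrite eseries0// => i _ _; exact: mA.
  + apply/eqP; rewrite -measure_le0; apply: le_trans (@measure_sigma_subadditive _ _ _ mu _
    (fun n => L (c - n.+1%:R^-1)) _ _ (@subset_refl _ _)) _.
    * by move=> n.
    * exact: bigcupT_measurable.
    * by rewrite eseries0// => i _ _; exact: mB.
- move=> x /= /eqP; rewrite neq_lt => /orP[axc|cax]; [right|left].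
    have [|n nl] := @small_inv _ (c - a x); first by rewrite subr_gt0.
    by exists n => //; rewrite /L/= in_itv/= lerBrDr -lerBrDl ltW.
  have [|n nl] := @small_inv _ (a x - c); first by rewrite subr_gt0.
  exists n => //; rewrite /L/= in_itv/=; apply/negP; by rewrite -ltNge -ltrBrDl.
Qed.

Lemma ergodic_const (f : X -> X) (a : X -> R) : ergodic mu f ->
  measurable_fun setT a -> (forall x, 0 <= a x <= 1) -> (forall x, a (f x) = a x) ->
  exists2 c, 0 <= c <= 1 & {ae mu, forall x, a x = c}.
Proof.
move=> ef ma a01 af; apply: zero_one_const => // t.
apply: ef; first by rewrite -[X in measurable X]setTI; exact: ma.
by apply/seteqP; split => x; rewrite /= !in_itv/= af.
Qed.

(** The upper limit of the preimages of [A] under the iterates of [f] is strictly invariant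
    and differs from [A] by a null set. *)
Lemma ergodic_ae_set (f : X -> X) A : ergodic mu f -> measurable_fun setT f ->
  (forall A, measurable A -> mu (f @^-1` A) = mu A) ->
  measurable A -> {ae mu, forall x, A (f x) <-> A x} -> mu A = 0%E \/ mu A = 1%E.
Proof.
move=> ef mf fmu mA [N [mN N0 NA]].
have mpre n B : measurable B -> measurable (iter n f @^-1` B).
  elim: n B => // n IH B mB; rewrite (_ : _ @^-1` B = iter n f @^-1` (f @^-1` B)).
    by apply: IH; rewrite -[X in measurable X]setTI; exact: mf.
  by apply/funext => x; rewrite /= -iterS.
have mupre n B : measurable B -> mu (iter n f @^-1` B) = mu B.
  elim: n B => // n IH B mB; rewrite (_ : _ @^-1` B = iter n f @^-1` (f @^-1` B)).
    by rewrite IH ?fmu// -[X in measurable X]setTI; exact: mf.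
  by apply/funext => x; rewrite /= -iterS.
pose A' := \bigcap_n \bigcup_(j in [set j | (n <= j)%N]) (iter j f @^-1` A).
have mA' : measurable A'.
  by apply: bigcapT_measurable => n; apply: bigcup_measurable => j _; exact: mpre.
have A'inv : f @^-1` A' = A'.
  apply/seteqP; split => x A'x n _.
    have [j /= nj Aj] := A'x n I; exists j.+1 => /=; first exact: leqW.
    by move: Aj; rewrite /= -iterSr.
  have [[//|j] /= nj Aj] := A'x n.+1 I; exists j => //=.
  by rewrite -iterSr.
pose M := \bigcup_n iter n f @^-1` N.
have mM : measurable M by apply: bigcupT_measurable => n; exact: mpre.
have M0 : mu M = 0%E.
  apply/eqP; rewrite -measure_le0; apply: le_trans (@measure_sigma_subadditive _ _ _ mu _
    (fun n => iter n f @^-1` N) _ _ (@subset_refl _ _)) _ => //.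
  - by move=> n; exact: mpre.
  - by rewrite eseries0// => i _ _; apply: etrans (mupre i N mN) N0.
have AA' x : ~ M x -> A' x <-> A x.
  move=> nMx; have Aj j : A (iter j f x) <-> A x.
    elim: j => // j IH; rewrite iterS; apply: iff_trans IH.
    by apply: contrapT => H; apply: nMx; exists j => //; exact: NA.
  split => [A'x|Ax n _]; first by have [j _ /Aj] := A'x 0%N I.
  by exists n => //=; apply/Aj.
suff -> : mu A = mu A' by exact: ef.
have mC B : measurable B -> mu B = mu (B `\` M).
  by move=> mB; rewrite (measureDI mu mB mM) [X in (_ + X)%E](@subset_measure0 _ _ _ mu
    _ M) ?adde0//; exact: measurableI.
rewrite mC// [RHS]mC//; congr (mu _); apply/seteqP; split => x [Bx nMx]; split => //; exact/AA'.
Qed.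

Lemma ergodic_ae_const (f : X -> X) (a : X -> R) : ergodic mu f -> measurable_fun setT f ->
  (forall A, measurable A -> mu (f @^-1` A) = mu A) ->
  measurable_fun setT a -> (forall x, 0 <= a x <= 1) -> {ae mu, forall x, a (f x) = a x} ->
  exists2 c, 0 <= c <= 1 & {ae mu, forall x, a x = c}.
Proof.
move=> ef mf fmu ma a01 af; apply: zero_one_const => // t.
apply: (ergodic_ae_set ef mf fmu); first by rewrite -[X in measurable X]setTI; exact: ma.
by apply: filterS af => x afx; rewrite /= !in_itv/= afx.
Qed.

End probability_facts.

Lemma section_swap (R : realType) d1 d2 (X : measurableType d1) (Y : measurableType d2)
  (m1 : probability X R) (m2 : probability Y R) (S : set (X * Y)) : measurable S ->
  (\int[m1]_x m2 (xsection S x) = \int[m2]_y m1 (ysection S y))%E.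
Proof.
move=> mS; have := @indic_fubini_tonelli _ _ _ _ _ m1 m2 S mS.
by rewrite indic_fubini_tonelli_FE// indic_fubini_tonelli_GE.
Qed.

Section ergodic_product.
Context (R : realType) d d' (X : measurableType d) (X' : measurableType d').
Context (mu : probability X R) (mu' : probability X' R) (f : X -> X) (f' : X' -> X').
Hypotheses (mf : measurable_fun setT f) (mf' : measurable_fun setT f').
Hypotheses (fmu : forall A, measurable A -> mu (f @^-1` A) = mu A)
  (fmu' : forall A, measurable A -> mu' (f' @^-1` A) = mu' A).

(** For an invariant set [C] with sections [C_y], the function
    [(x1, x2) |-> mu' {y | C (x1, y) /\ C (x2, y)}] is invariant under [f * f], hence a
    constant [c]. So the function [q B y = mu (C_y `&` B)] satisfies
    [\int q B1 * q B2 = c * mu B1 * mu B2], and the moments force [q B] to equal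
    [mu B * q setT] almost everywhere; as [q setT] is constant by ergodicity of [f'], the
    set [C] is independent of all rectangles, and so of itself. *)
Lemma ergodic_product : ergodic (mu \x mu)%E (prod_map f f) -> ergodic mu' f' ->
  ergodic (mu \x mu')%E (prod_map f f').
Proof.
move=> eff ef' C mC Cinv.
have CE x y : C (f x, f' y) = C (x, y) by rewrite -[in RHS]Cinv.
pose D : set ((X * X) * X') := [set w | C (w.1.1, w.2) /\ C (w.1.2, w.2)].
have mD : measurable D.
  apply: (@measurableI _ _ ((fun w : (X * X) * X' => (w.1.1, w.2)) @^-1` C)
     ((fun w : (X * X) * X' => (w.1.2, w.2)) @^-1` C)).
    rewrite -[X in measurable X]setTI.
    suff : measurable_fun setT (fun w : (X * X) * X' => (w.1.1, w.2)) by exact.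
    apply: measurable_fun_pair => //.
    exact: (measurableT_comp measurable_fst measurable_fst).
  rewrite -[X in measurable X]setTI.
  suff : measurable_fun setT (fun w : (X * X) * X' => (w.1.2, w.2)) by exact.
  apply: measurable_fun_pair => //.
  exact: (measurableT_comp measurable_snd measurable_fst).
pose K z := fine (mu' (xsection D z)).
have KE z : (K z)%:E = mu' (xsection D z).
  by rewrite probability_fineK//; exact: measurable_xsection.
have mK : measurable_fun setT K.
  apply/measurable_EFinP; rewrite (_ : EFin \o K = mu' \o xsection D); last first.
    by apply/funext => z /=; rewrite KE.
  exact: measurable_fun_xsection.
have [|||c c01 [N [mN N0 KN]]] := @ergodic_const _ _ _ _ _ K eff => //.
- by move=> z; apply: probability_fine01; exact: measurable_xsection.
- move=> z; rewrite /K -[in LHS]fmu'; last exact: measurable_xsection.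
  by congr (fine (mu' _)); rewrite !xsectionE; apply/funext => y; rewrite /D/= !CE.
pose q B y := fine (mu (ysection C y `&` B)).
have qE B y : measurable B -> (q B y)%:E = mu (ysection C y `&` B).
  by move=> mB; rewrite probability_fineK//; apply: measurableI => //; exact: measurable_ysection.
have CB B : measurable B -> measurable (C `&` (B `*` setT)).
  by move=> mB; apply: measurableI => //; exact: measurableX.
have yCB B y : ysection (C `&` (B `*` setT)) y = ysection C y `&` B.
  by rewrite !ysectionE; apply/seteqP; split => x /= [Cx]; [move=> []|].
have mq B : measurable B -> measurable_fun setT (q B).
  move=> mB; apply/measurable_EFinP.
  rewrite (_ : EFin \o q B = mu \o ysection (C `&` (B `*` setT))); last first.
    by apply/funext => y /=; rewrite qE// yCB.
  by apply: measurable_fun_ysection; exact: CB.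
have q0 B y : 0 <= q B y by rewrite fine_ge0.
have qq B1 B2 : measurable B1 -> measurable B2 ->
    (\int[mu']_y (q B1 y * q B2 y)%:E = c%:E * (mu B1 * mu B2))%E.
  move=> mB1 mB2.
  pose D' := D `&` ((B1 `*` B2) `*` setT).
  have mD' : measurable D' by apply: measurableI => //; apply: measurableX => //;
    exact: measurableX.
  have := section_swap [the probability _ R of (mu \x mu)%E] mu' mD'.
  rewrite (eq_integral (fun y => (q B1 y * q B2 y)%:E)); last first.
    move=> y _ /=; rewrite EFinM !qE// -product_measure1E//; try by
      apply: measurableI => //; exact: measurable_ysection.
    congr ((mu \x mu)%E _); rewrite !ysectionE.
    by apply/seteqP; split => -[x1 x2] /= => [[[? ?] [[? ?] _]]|[[? ?] [? ?]]].
  move=> <-.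
  transitivity (\int[(mu \x mu)%E]_z (c%:E * (\1_(B1 `*` B2) z)%:E))%E; last first.
    rewrite ge0_integralZl//; last 2 first.
    - by apply/measurable_EFinP; apply: measurable_indic; exact: measurableX.
    - by rewrite lee_fin; case/andP: c01.
    - rewrite integral_indic//; last exact: measurableX.
      by rewrite setIT; congr (_ * _)%E; exact: product_measure1E.
  apply: ge0_ae_eq_integral => //.
  - exact: measurable_fun_xsection.
  - apply: emeasurable_funM => //; apply/measurable_EFinP; apply: measurable_indic.
    exact: measurableX.
  - by move=> z _; rewrite mule_ge0// lee_fin; case/andP: c01.
  - exists N; split => // z /= H; apply: KN => /= Kz; apply: H => _.
    have [Bz|nBz] := pselect ((B1 `*` B2) z).
      rewrite indicE mem_set// mule1 -Kz KE; congr (mu' _).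
      by rewrite !xsectionE; apply/seteqP; split => y /= => [[]|].
    rewrite indicE memNset// mule0 (_ : xsection _ _ = set0) ?measure0//.
    by rewrite xsectionE -subset0 => y /= [_ []].
have PE S : measurable S -> ((mu \x mu') S = \int[mu']_y mu (ysection S y))%E.
  by move=> mS; rewrite -section_swap.
have [|||p p01 qTp] := @ergodic_const _ _ _ _ _ (q setT) ef'.
- exact: mq.
- move=> y; apply: probability_fine01; apply: measurableI => //; exact: measurable_ysection.
- move=> y; rewrite /q -[in LHS]fmu; last by apply: measurableI => //; exact: measurable_ysection.
  by congr (fine (mu _)); rewrite !setIT !ysectionE; apply/funext => x; rewrite /= CE.
have qB B : measurable B -> {ae mu', forall y, q B y = fine (mu B) * q setT y}.
  move=> mB; set m := fine (mu B).
  have m0 : 0 <= m by rewrite fine_ge0.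
  have mE : m%:E = mu B by rewrite probability_fineK.
  apply: (@ae_eq_of_moments _ _ _ _ _ _ (c * (m * m))) => //.
  - exact: mq.
  - by apply: measurable_funM => //; exact: mq.
  - by move=> y; rewrite mulr_ge0.
  - under eq_integral do rewrite mulrCA EFinM.
    rewrite ge0_integralZl//; last 2 first.
    + by apply/measurable_EFinP; apply: measurable_funM; exact: mq.
    + by move=> y _; rewrite lee_fin mulr_ge0.
    + by rewrite qq// probability_setT mule1 -mE -!EFinM; congr EFin; ring.
  - by rewrite qq// -mE -!EFinM.
  - under eq_integral do rewrite mulrACA EFinM.
    rewrite ge0_integralZl//; last 3 first.
    + by apply/measurable_EFinP; apply: measurable_funM; exact: mq.
    + by move=> y _; rewrite lee_fin mulr_ge0.
    + by rewrite lee_fin mulr_ge0.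
    + by rewrite qq// probability_setT !mule1 -!EFinM; congr EFin; ring.
case/andP: p01 => p0 p1.
pose m1 := mrestr (mu \x mu')%E mC.
pose m2 := mscale (NngNum p0) (mu \x mu')%E.
have m1E S : m1 S = (mu \x mu')%E (S `&` C) by [].
have m2E S : m2 S = (p%:E * (mu \x mu')%E S)%E by [].
have m12 S : measurable S -> m1 S = m2 S.
  move=> mS; apply: (rect_measure_unique (m1 := m1) (m2 := m2)) => //.
    by rewrite /m1 /mrestr; apply: le_lt_trans (probability_le1 _ _) _; rewrite ?ltry//;
      exact: measurableI.
  move=> B A mB mA.
  suff : (mu \x mu')%E ((B `*` A) `&` C) = (p%:E * (mu \x mu')%E (B `*` A))%E by [].
  rewrite PE; last by apply: measurableI => //; exact: measurableX.
  transitivity (\int[mu']_y ((p * fine (mu B))%:E * (\1_A y)%:E))%E; last first.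
    rewrite ge0_integralZl//; last 2 first.
    - by apply/measurable_EFinP; apply: measurable_indic.
    - by rewrite lee_fin mulr_ge0// fine_ge0.
    - by rewrite integral_indic// ?setIT ?product_measure1E// EFinM probability_fineK// muleA.
  apply: ge0_ae_eq_integral => //.
  - by apply: measurable_fun_ysection; apply: measurableI => //; exact: measurableX.
  - apply: emeasurable_funM => //; apply/measurable_EFinP; exact: measurable_indic.
  - by move=> y _; rewrite mule_ge0// lee_fin mulr_ge0// fine_ge0.
  - apply: filterS2 qTp (qB B mB) => y qTy qBy _.
    have [Ay|nAy] := pselect (A y).
      rewrite indicE mem_set// mule1 mulrC -qTy -qBy qE//; congr (mu _).
      by rewrite !ysectionE; apply/seteqP; split => x /= => [[[]]|[]].
    rewrite indicE memNset// mule0 (_ : ysection _ _ = set0) ?measure0//.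
    by rewrite ysectionE -subset0 => x /= [[]].
have PC : (mu \x mu')%E C = p%:E.
  have := m12 setT measurableT; rewrite m1E m2E setTI => ->.
  by rewrite probability_setT mule1.
have := m12 C mC; rewrite m1E m2E setIid PC -EFinM => -[pp].
have : p * (1 - p) = 0 by rewrite mulrBr mulr1 -pp subrr.
move/eqP; rewrite mulf_eq0 subr_eq0 => /orP[/eqP p00|/eqP p11].
  by left; apply: etrans PC _; rewrite p00.
by right; apply: etrans PC _; rewrite -p11.
Qed.

End ergodic_product.

Definition image_prob (R : realType) d e (W : measurableType d) (V : measurableType e)
  (P : probability W R) (theta : W -> V) (mt : measurable_fun setT theta) : probability V R :=
  distribution P (mfun_Sub (mem_set mt)).

Lemma image_probE (R : realType) d e (W : measurableType d) (V : measurableType e)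
  (P : probability W R) (theta : W -> V) (mt : measurable_fun setT theta) A :
  image_prob P mt A = P (theta @^-1` A).
Proof. by []. Qed.

Lemma rect_prob_unique (R : realType) d1 d2 (X : measurableType d1) (Y : measurableType d2)
  (m1 m2 : probability (X * Y)%type R) :
  (forall A B, measurable A -> measurable B -> m1 (A `*` B) = m2 (A `*` B)) ->
  forall C, measurable C -> m1 C = m2 C.
Proof.
move=> H; apply: rect_measure_unique => //.
by rewrite (le_lt_trans (probability_le1 _ _)) ?ltry.
Qed.

Lemma measurable_preimage d e (W : measurableType d) (V : measurableType e) (f : W -> V) A :
  measurable_fun setT f -> measurable A -> measurable (f @^-1` A).
Proof. by move=> mf mA; rewrite -[X in measurable X]setTI; exact: mf. Qed.

Lemma ergodic_factor (R : realType) d e (W : measurableType d) (V : measurableType e)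
  (P : probability W R) (Q : probability V R) (F : W -> W) (G : V -> V) (theta : W -> V) :
  measurable_fun setT theta -> (forall A, measurable A -> P (theta @^-1` A) = Q A) ->
  (forall w, theta (F w) = G (theta w)) -> ergodic P F -> ergodic Q G.
Proof.
move=> mt PQ tF eF A mA GA; rewrite -PQ//.
apply: eF; first exact: measurable_preimage.
by rewrite -[in RHS]GA; apply/funext => w; rewrite /= tF.
Qed.

Section weak_mixing.
Context (R : realType).

Lemma weakly_mixing_ergodic d (X : measurableType d) (mu : probability X R) (f : X -> X) :
  weakly_mixing mu f -> ergodic mu f.
Proof.
apply: (ergodic_factor (theta := fst)) => //.
move=> A mA; rewrite (_ : fst @^-1` A = A `*` setT); last first.
  by apply/seteqP; split => -[x y] //= [].
rewrite [LHS]product_measure1E// -[RHS]mule1; congr (_ * _)%E.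
exact: probability_setT.
Qed.

Lemma prod_map_preserving d e (X : measurableType d) (Y : measurableType e)
  d' e' (X' : measurableType d') (Y' : measurableType e')
  (mu : probability X R) (nu : probability Y R) (mu' : probability X' R) (nu' : probability Y' R)
  (f : X -> X') (g : Y -> Y') :
  measurable_fun setT f -> measurable_fun setT g ->
  (forall A, measurable A -> mu (f @^-1` A) = mu' A) ->
  (forall A, measurable A -> nu (g @^-1` A) = nu' A) ->
  forall C, measurable C -> (mu \x nu)%E ((fun z => (f z.1, g z.2)) @^-1` C) = (mu' \x nu')%E C.
Proof.
move=> mf mg fmu gnu C mC.
have mfg : measurable_fun setT (fun z : X * Y => (f z.1, g z.2)).
  by apply: measurable_fun_pair; [exact: measurableT_comp mf _|exact: measurableT_comp mg _].
rewrite -[LHS](image_probE (mu \x nu)%E mfg).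
apply: rect_prob_unique mC => A B mA mB.
transitivity ((mu \x nu)%E ((f @^-1` A) `*` (g @^-1` B))) => //.
rewrite product_measure1E; try exact: measurable_preimage.
rewrite [RHS]product_measure1E//.
by congr (_ * _)%E; [exact: fmu|exact: gnu].
Qed.

Lemma weakly_mixing_factor d e (W : measurableType d) (V : measurableType e)
  (P : probability W R) (Q : probability V R) (F : W -> W) (G : V -> V) (theta : W -> V) :
  measurable_fun setT theta -> (forall A, measurable A -> P (theta @^-1` A) = Q A) ->
  (forall w, theta (F w) = G (theta w)) -> weakly_mixing P F -> weakly_mixing Q G.
Proof.
move=> mt PQ tF; apply: (ergodic_factor (theta := fun z => (theta z.1, theta z.2))).
- by apply: measurable_fun_pair; exact: measurableT_comp mt _.
- exact: prod_map_preserving.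
- by move=> [w1 w2]; rewrite /prod_map/= !tF.
Qed.

(** Ergodicity passes from [f * f] to [f * f'] for any ergodic [f'], so weak mixing lets the
    factors be added one by one to [g * g]. *)
Lemma weakly_mixing_prod d e (X : measurableType d) (Y : measurableType e)
  (mu : probability X R) (nu : probability Y R) (f : X -> X) (g : Y -> Y) :
  measurable_fun setT f -> measurable_fun setT g ->
  (forall A, measurable A -> mu (f @^-1` A) = mu A) ->
  (forall A, measurable A -> nu (g @^-1` A) = nu A) ->
  weakly_mixing mu f -> weakly_mixing nu g -> weakly_mixing (mu \x nu)%E (prod_map f g).
Proof.
move=> mf mg fmu gnu wf wg.
have mff : measurable_fun setT (prod_map g g).
  by apply: measurable_fun_pair; exact: measurableT_comp mg _.
have mfg : measurable_fun setT (prod_map f (prod_map g g)).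
  by apply: measurable_fun_pair; [exact: measurableT_comp mf _|exact: measurableT_comp mff _].
have pgg := prod_map_preserving mg mg gnu gnu.
have pfg := prod_map_preserving mf mff fmu pgg.
have e1 : ergodic (mu \x (nu \x nu))%E (prod_map f (prod_map g g)).
  exact: ergodic_product.
have e2 : ergodic (mu \x (mu \x (nu \x nu)))%E (prod_map f (prod_map f (prod_map g g))).
  exact: ergodic_product.
pose th (w : X * (X * (Y * Y))) : (X * Y) * (X * Y) := ((w.1, w.2.2.1), (w.2.1, w.2.2.2)).
have mth : measurable_fun setT th.
  have m22 : measurable_fun setT (fun w : X * (X * (Y * Y)) => w.2.2).
    exact: (measurableT_comp measurable_snd measurable_snd).
  apply: measurable_fun_pair; apply: measurable_fun_pair => //.
  - exact: (measurableT_comp measurable_fst m22).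
  - exact: (measurableT_comp measurable_fst measurable_snd).
  - exact: (measurableT_comp measurable_snd m22).
apply: (ergodic_factor (theta := th)) e2 => //.
move=> C mC; rewrite -[LHS](image_probE (mu \x (mu \x (nu \x nu)))%E mth).
apply: rect_prob_unique mC => A B mA mB.
rewrite [RHS]product_measure1E// image_probE.
transitivity (\int[mu]_x1 (nu (xsection A x1) * (mu \x nu)%E B))%E; last first.
  rewrite ge0_integralZr//; exact: measurable_fun_xsection.
apply: eq_integral => x1 _ /=.
transitivity (\int[mu]_x2 (nu (xsection A x1) * nu (xsection B x2)))%E; last first.
  rewrite ge0_integralZl//; exact: measurable_fun_xsection.
apply: eq_integral => x2 _ /=.
rewrite -product_measure1E; try exact: measurable_xsection.
congr ((nu \x nu)%E _); rewrite !xsectionE.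
by apply/seteqP; split => -[y1 y2].
Qed.

End weak_mixing.

Section power_automorphism.
Context (R : realType) (S : automorphism R).
Local Notation Y := (aut_space S).
Local Notation nu := (aut_measure S).
Local Notation g := (aut_map S).

Lemma aut_measurable : measurable_fun setT g.
Proof. by have [? []] := aut_invertible S. Qed.

Lemma aut_preserving A : measurable A -> nu (g @^-1` A) = nu A.
Proof. by have [? [_ _ _ _]] := aut_invertible S; apply. Qed.

Lemma measurable_power_map n (f : Y -> Y) : measurable_fun setT f ->
  measurable_fun setT (power_map n f).
Proof.
move=> mf; apply/measurable_fun_tnthP => i.
rewrite (_ : _ \o _ = f \o (fun t => tnth t i)).
  exact: measurableT_comp mf (measurable_tnth i).
by apply/funext => t /=; rewrite tnth_map.
Qed.

Lemma power_map_cons n (f : Y -> Y) (z : Y * n.-tuple Y) :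
  power_map n.+1 f (tuple_cons z) = tuple_cons (f z.1, power_map n f z.2).
Proof. exact: val_inj. Qed.

Lemma power_preserving n A : measurable A ->
  power_measure nu n (power_map n g @^-1` A) = power_measure nu n A.
Proof.
elim: n A => [|n IH] A mA.
  by congr (power_measure nu 0 _); apply/seteqP; split=> t /=;
    rewrite (tuple0 (power_map _ _ _)) (tuple0 t).
rewrite /= /distribution /pushforward.
rewrite -[in RHS](prod_map_preserving aut_measurable
  (measurable_power_map aut_measurable) aut_preserving IH).
  by congr ((_ \x _)%E _); apply/funext => z; rewrite /= power_map_cons.
by apply: measurable_preimage mA; exact: measurable_tuple_cons.
Qed.

Lemma power_invertible n : invertible_measure_preserving (power_measure nu n) (power_map n g).
Proof.
have [g' [gK gK' mg mg' _]] := aut_invertible S.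
exists (power_map n g'); split.
- by move=> t; apply: eq_from_tnth => i; rewrite !tnth_map gK.
- by move=> t; apply: eq_from_tnth => i; rewrite !tnth_map gK'.
- exact: measurable_power_map.
- exact: measurable_power_map.
- exact: power_preserving.
Qed.

Definition power_automorphism n : automorphism R :=
  Automorphism (standard_borel_tuple n (aut_standard S)) (power_invertible n).

Lemma power_weakly_mixing n : weakly_mixing nu g ->
  weakly_mixing (power_measure nu n) (power_map n g).
Proof.
move=> wg; elim: n => [|n IH].
  move=> A mA _; have [->|/set0P[[t1 t2] At]] := eqVneq A set0; first by left; rewrite measure0.
  right; rewrite (_ : A = setT) ?probability_setT//.
  by apply/seteqP; split => // -[u1 u2] _; rewrite (tuple0 u1) (tuple0 u2); move: At;
    rewrite (tuple0 t1) (tuple0 t2).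
apply: (weakly_mixing_factor (theta := @tuple_cons _ Y n)).
- exact: measurable_tuple_cons.
- by [].
- by move=> z; rewrite power_map_cons.
- apply: weakly_mixing_prod wg IH => //.
  + exact: aut_measurable.
  + exact: measurable_power_map aut_measurable.
  + exact: aut_preserving.
  + exact: power_preserving.
Qed.

End power_automorphism.

(** * Extreme points of compact sets of functions *)

Section extreme_point.
Context (R : realType) (I : eqType).
Local Notation T := {ptws I -> R}.
Variable K : set T.
Hypothesis cK : compact K.
Hypothesis clK : closed K.

Lemma coord_continuous (p : I) : continuous (fun m : T => m p : R).
Proof. exact: proj_continuous. Qed.

Definition midpoint (m m1 m2 : T) := forall p, m p = (m1 p + m2 p) / 2.

Definition face (F : set T) := [/\ closed F, F `<=` K, F !=set0 &
  forall m m1 m2, K m1 -> K m2 -> midpoint m m1 m2 -> F m -> F m1 /\ F m2].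

Definition top (F : set T) (p : I) := F `&` [set m | forall m', F m' -> m' p <= m p].

Lemma face_compact F : face F -> compact F.
Proof. by move=> [cF FK _ _]; apply: subclosed_compact cK FK. Qed.

(** A coordinate attains its maximum on a face, and if a midpoint attains it so do both
    ends. *)
Lemma face_top F p : face F -> face (top F p).
Proof.
move=> fF; have [cF FK F0 Fm] := fF.
have [|c /set_mem Fc cmax] := @compact_EVT_max _ _ (fun m : T => m p : R) F F0 (face_compact fF).
  by apply: continuous_subspaceT; exact: coord_continuous.
have topE : top F p = F `&` (fun m : T => m p : R) @^-1` [set x | c p <= x].
  apply/seteqP; split => m [Fm' H]; split => //=; first exact: H.
  by move=> m' Fm''; apply: le_trans H; apply: cmax; exact: mem_set.
split.
- rewrite topE; apply: closedI => //; apply: closed_comp; last exact: closed_ge.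
  by move=> x _; exact: coord_continuous.
- by move=> m [/FK].
- by exists c; split => // m' Fm'; apply: cmax; exact: mem_set.
- rewrite topE => m m1 m2 K1 K2 mm [Fmm /= cm].
  have [F1 F2] := Fm m m1 m2 K1 K2 mm Fmm.
  have c1 := cmax m1 (mem_set F1); have c2 := cmax m2 (mem_set F2).
  move: cm; rewrite mm => cm.
  by split; split => //=; lra.
Qed.

(** A minimal face inside the face on which the coordinate [p0] is maximal exists by Zorn's
    lemma, since a chain of faces has a nonempty intersection by compactness. All
    coordinates are constant on a minimal face, which therefore is a single point. *)
Lemma exists_extreme_point (m0 : T) (p0 : I) : K m0 -> exists m, [/\ K m, m0 p0 <= m p0 &
  forall m1 m2, K m1 -> K m2 -> midpoint m m1 m2 -> m1 = m2].
Proof.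
move=> K0.
have fK : face K by split => //; exists m0.
pose F0 := top K p0; have fF0 : face F0 := face_top p0 fK.
have [cF0 F0K nF0 F0m] := fF0.
(* Zorn's lemma is about unions, hence it is applied to the complements [U] in [F0] of the
   faces. *)
have [|U [fU Umax]] := @Zorn_bigcup _ [set U | face (F0 `\` U)].
  move=> Fam fFam tFam.
  have capE : F0 `\` \bigcup_(X in Fam) X = F0 `&` \bigcap_(X in Fam) (F0 `\` X).
    apply/seteqP; split => m [F0m' H]; split => //.
      by move=> X FX; split => // Xm; apply: H; exists X.
    by move=> [X FX Xm]; have [] := H X FX.
  rewrite /= capE; split.
  - by apply: closedI => //; apply: closed_bigI => X /fFam[].
  - by move=> m [/F0K].
  - have [[X0 FX0]|Fam0] := pselect (Fam !=set0); last first.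
      have [m F0m'] := nF0; exists m; split => // X FX; exfalso; apply: Fam0; by exists X.
    pose G := filter_from Fam (fun X => F0 `\` X).
    have GG : ProperFilter G.
      apply: filter_from_proper; last by move=> X /fFam[].
      apply: filter_from_filter; first by exists X0.
      move=> X Y FX FY; have [XY|YX] := tFam X Y FX FY.
        by exists Y => // m [F0m' nY]; split; split => // /XY.
      by exists X => // m [F0m' nX]; split; split => // /YX.
    have GF0 : G F0 by exists X0 => // m [].
    have [m [F0m' cm]] := face_compact fF0 GG GF0.
    exists m; split => // X FX.
    have [cX _ _ _] := fFam X FX; apply: cX => B nB.
    by apply: cm => //; exists X.
  - move=> m m1 m2 K1 K2 mm [F0m' Hm].
    have [F1 F2] := F0m m m1 m2 K1 K2 mm F0m'.
    split; split => // X FX; have [_ _ _ /(_ m m1 m2 K1 K2 mm (Hm X FX))[]] := fFam X FX; by [].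
have [cU UK [m [F0m' nUm]] Um] := fU.
have topU p : F0 `\` U `<=` top (F0 `\` U) p.
  have ft := face_top p fU.
  apply: contrapT => ntop.
  apply: (Umax (U `|` (F0 `\` top (F0 `\` U) p))).
    split; first by apply/subsetUl.
    move=> H; apply: ntop => x [F0x nUx].
    by apply: contrapT => nt; apply: nUx; apply: H; right; split.
  rewrite /= (_ : _ `\` _ = top (F0 `\` U) p)//.
  apply/seteqP; split => x.
    by move=> [F0x nx]; apply: contrapT => nt; apply: nx; right; split.
  by move=> tx; have [[F0x nUx] _] := tx; split => // -[//|[]].
exists m; split.
- exact: F0K.
- by have [_] := F0m'; apply.
- move=> m1 m2 K1 K2 mm; have [U1 U2] := Um m m1 m2 K1 K2 mm (conj F0m' nUm).
  apply/funext => p; apply/eqP; rewrite eq_le; apply/andP; split.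
    by have [_] := topU p m2 U2; apply.
  by have [_] := topU p m1 U1; apply.
Qed.

End extreme_point.

(** * Ergodic joinings *)

Lemma integral_image (R : realType) d e (W : measurableType d) (V : measurableType e)
  (P : probability W R) (Q : probability V R) (theta : W -> V) (D : set V) (f : V -> \bar R) :
  measurable_fun setT theta -> (forall A, measurable A -> P (theta @^-1` A) = Q A) ->
  measurable D -> measurable_fun setT f -> (forall y, 0 <= f y)%E ->
  (\int[Q]_(y in D) f y = \int[P]_(x in theta @^-1` D) f (theta x))%E.
Proof.
move=> mt PQ mD mf f0.
rewrite -(ge0_integral_pushforward mt P mD)//; last exact: measurable_funTS.
apply: eq_measure_integral => A mA _; exact/esym/PQ.
Qed.

Section conditional_density.
Context (R : realType) d e (W : measurableType d) (V : measurableType e).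
Context (P : probability W R) (Q : probability V R) (theta : W -> V) (E : set W).
Hypotheses (mt : measurable_fun setT theta) (mE : measurable E).
Hypothesis PQ : forall A, measurable A -> P (theta @^-1` A) = Q A.

(** The law of [theta] restricted to the event [E]. The proofs among the arguments let the
    measure structure declared below be found from the term alone. *)
Definition trace_image (_ : measurable_fun setT theta) (_ : measurable E) (A : set V) : \bar R :=
  P (E `&` theta @^-1` A).
Local Notation q := (trace_image mt mE).

Let mth A : measurable A -> measurable (theta @^-1` A).
Proof. exact: measurable_preimage. Qed.

Let q0 : q set0 = 0%E. Proof. by rewrite /trace_image preimage_set0 setI0 measure0. Qed.
Let q_ge0 A : (0 <= q A)%E. Proof. exact: measure_ge0. Qed.
Let q_sigma : semi_sigma_additive q.
Proof.
move=> F mF tF mUF; rewrite /trace_image preimage_bigcup setI_bigcupr.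
apply: measure_semi_sigma_additive.
- by move=> n; apply: measurableI => //; exact: mth.
- apply/trivIsetP => /= i j _ _ ij; rewrite setIACA setIid -preimage_setI.
  by move/trivIsetP : tF => /(_ _ _ _ _ ij) ->//; rewrite preimage_set0 setI0.
- by rewrite -setI_bigcupr -preimage_bigcup; apply: measurableI => //; exact: mth.
Qed.
HB.instance Definition _ := isMeasure.Build _ _ _ q q0 q_ge0 q_sigma.

Lemma trace_image_le A : measurable A -> (q A <= Q A)%E.
Proof.
move=> mA; rewrite -PQ//; apply: le_measure; rewrite ?inE//; last exact: mth.
by apply: measurableI => //; exact: mth.
Qed.

Let q_fin : fin_num_fun q.
Proof.
move=> A mA; apply/fin_num_measure/measurableI => //; exact: mth.
Qed.
HB.instance Definition _ := Measure_isFinite.Build _ _ _ q q_fin.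

(** The density of the law of [theta] on [E] is at most [1] almost everywhere; it is
    truncated so that the bound holds everywhere. *)
Lemma conditional_density : exists h : V -> R, [/\ measurable_fun setT h,
  forall x, 0 <= h x <= 1 &
  forall A, measurable A -> P (E `&` theta @^-1` A) = (\int[Q]_(x in A) (h x)%:E)%E].
Proof.
have qQ : q `<< Q.
  apply/null_content_dominatesP => A mA QA.
  by apply/eqP; rewrite eq_le measure_ge0 andbT -QA trace_image_le.
pose f := Radon_Nikodym_SigmaFinite.f [the {finite_measure set V -> \bar R} of q] Q.
have f0 x : (0 <= f x)%E by exact: Radon_Nikodym_SigmaFinite.f_ge0.
have ffin x : f x \is a fin_num by exact: Radon_Nikodym_SigmaFinite.f_fin_num.
have intf : Q.-integrable setT f by exact: Radon_Nikodym_SigmaFinite.f_integrable.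
have qE A : measurable A -> q A = (\int[Q]_(x in A) f x)%E.
  by move=> mA; rewrite -Radon_Nikodym_SigmaFinite.f_integral.
have mf : measurable_fun setT f by exact: measurable_int intf.
pose h x := Num.min (fine (f x)) 1.
have mh : measurable_fun setT h.
  by apply: measurable_minr => //; apply: measurableT_comp.
have h01 x : 0 <= h x <= 1.
  by rewrite /h le_min ler01 fine_ge0//= ge_min lexx orbT.
exists h; split => // A mA; rewrite -[LHS]/(q A).
pose B := [set x | (1 < f x)%E].
have mB : measurable B.
  by rewrite -[B]setTI; apply: emeasurable_fun_o_infty.
have mAB := measurableI _ _ mA mB; have mADB := measurableD mA mB.
have hf x : ~ B x -> (h x)%:E = f x.
  rewrite /B/= => /negP; rewrite -leNgt => f1.
  rewrite /h min_l ?fineK// -lee_fin fineK//.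
have hB x : B x -> (h x)%:E = 1%E.
  rewrite /B/= => /ltW f1; rewrite /h min_r// -lee_fin fineK//.
have UAB : A = (A `\` B) `|` (A `&` B) by rewrite setUC setUIDK.
have -> : q A = (q (A `\` B) + q (A `&` B))%E.
  by rewrite {1}UAB; apply: measureU => //; rewrite setDE setIACA setICl setI0.
rewrite [in RHS]UAB ge0_integral_setU//; first last.
- by apply/disj_set2P; rewrite setDE setIACA setICl setI0.
- by move=> x _; rewrite lee_fin; case/andP: (h01 x).
- by apply/measurable_EFinP; exact: measurable_funTS.
congr (_ + _)%E.
  rewrite qE//; apply: eq_integral => x; rewrite inE => -[_ nB].
  by rewrite hf.
transitivity (Q (A `&` B)).
  apply/eqP; rewrite eq_le trace_image_le//= qE//.
  rewrite -[leLHS]mul1e -integral_cst//; apply: ge0_le_integral => //.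
  - exact: measurable_funTS.
  - by move=> x [_ /ltW].
rewrite -[LHS]mul1e -integral_cst//; apply: eq_integral => x; rewrite inE => -[_ Bx].
by rewrite hB.
Qed.

End conditional_density.

Lemma density_ae_unique (R : realType) d (X : measurableType d) (Q : probability X R)
  (h1 h2 : X -> R) : measurable_fun setT h1 -> measurable_fun setT h2 ->
  (forall x, 0 <= h1 x <= 1) ->
  (forall A, measurable A -> \int[Q]_(x in A) (h1 x)%:E = \int[Q]_(x in A) (h2 x)%:E)%E ->
  {ae Q, forall x, h1 x = h2 x}.
Proof.
move=> m1 m2 h01 h12.
have ih : Q.-integrable setT (EFin \o h1).
  apply/integrableP; split; first exact/measurable_EFinP.
  apply: (@le_lt_trans _ _ (\int[Q]_x (cst 1%E x)))%E; last first.
    by rewrite integral_cst// mul1e (le_lt_trans (probability_le1 _ _))// ltry.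
  apply: ge0_le_integral => //.
  - by apply: measurableT_comp => //; exact/measurable_EFinP.
  - by move=> x _; rewrite gee0_abs// lee_fin; case/andP: (h01 x).
have : ae_eq Q setT (EFin \o h1) (EFin \o h2).
  apply: integral_ae_eq => //; first exact/measurable_EFinP.
  by move=> B _ mB; exact: h12.
by apply: filterS => x /(_ I) [].
Qed.
(** The conditional probability of an invariant event given an ergodic factor is invariant,
    hence constant. *)
Lemma invariant_independent (R : realType) d e (W : measurableType d) (V : measurableType e)
  (P : probability W R) (Q : probability V R) (F : W -> W) (G : V -> V) (theta : W -> V)
    (C : set W) :
  measurable_fun setT theta -> (forall A, measurable A -> P (theta @^-1` A) = Q A) ->
  (forall w, theta (F w) = G (theta w)) ->
  measurable_fun setT F -> (forall A, measurable A -> P (F @^-1` A) = P A) ->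
  invertible_measure_preserving Q G -> ergodic Q G ->
  measurable C -> F @^-1` C = C ->
  forall A, measurable A -> P (C `&` theta @^-1` A) = (P C * Q A)%E.
Proof.
move=> mt PQ tF mF FP [G' [GK G'K mG mG' GQ]] eG mC CF A mA.
have [h [mh h01 hE]] := conditional_density mt mC PQ.
have hG : {ae Q, forall x, h (G x) = h x}.
  suff : {ae Q, forall x, h x = h (G x)} by apply: filterS.
  apply: density_ae_unique => //; first exact: measurableT_comp mh mG.
  move=> B mB.
  have BE : B = G @^-1` (G' @^-1` B).
    by rewrite -comp_preimage (_ : G' \o G = id)//; apply/funext => x /=; rewrite GK.
  have mB' : measurable (G' @^-1` B) by exact: measurable_preimage.
  rewrite -[LHS]hE// BE.
  transitivity (P (C `&` theta @^-1` (G' @^-1` B))).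
    rewrite -[RHS]FP; last by apply: measurableI => //; apply: measurable_preimage mB'.
    congr (P _); rewrite preimage_setI CF; congr (_ `&` _).
    by apply/funext => w /=; rewrite tF.
  rewrite hE// (integral_image mG GQ mB' (f := fun x => (h x)%:E))//.
    exact/measurable_EFinP.
  by move=> x; rewrite lee_fin; case/andP: (h01 x).
have [c c01 hc] := ergodic_ae_const eG mG GQ mh h01 hG.
have PA B : measurable B -> P (C `&` theta @^-1` B) = (c%:E * Q B)%E.
  move=> mB; rewrite hE// -integral_cst//; apply: ae_eq_integral => //.
  - by apply: measurable_funTS; exact/measurable_EFinP.
  - by apply: filterS hc => x -> _.
have := PA setT measurableT; rewrite preimage_setT setIT probability_setT mule1 => ->.
exact: PA.
Qed.

Section coupling_set.
Context (R : realType) (Z Y : automorphism R).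
Local Notation mu := (aut_measure Z).
Local Notation nu := (aut_measure Y).
Local Notation f := (aut_map Z).
Local Notation g := (aut_map Y).

Definition coupling_set : set {ptws (set Z * set Y) -> R} :=
  [set m | precoupling mu nu m /\
    forall A B, measurable A -> measurable B -> m (f @^-1` A, g @^-1` B) = m (A, B)].

Let closed_coord (h : {ptws (set Z * set Y) -> R} -> R) : continuous h ->
  closed [set m | h m = 0].
Proof.
by move=> ch; apply: (@closed_comp _ _ h [set 0]) => [x _|]; [exact: ch|exact: closed_eq].
Qed.

Lemma coupling_set_closed : closed coupling_set.
Proof.
have cc p := @coord_continuous R _ p : continuous (fun m : {ptws (set Z * set Y) -> R} => m p : R).
have cB (h1 h2 : {ptws (set Z * set Y) -> R} -> R) : continuous h1 -> continuous h2 ->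
    continuous (fun m => h1 m - h2 m) by move=> c1 c2 x; exact: (cvgB (c1 x) (c2 x)).
have cD (h1 h2 : {ptws (set Z * set Y) -> R} -> R) : continuous h1 -> continuous h2 ->
    continuous (fun m => h1 m + h2 m) by move=> c1 c2 x; exact: (cvgD (c1 x) (c2 x)).
have ck (c : R) : continuous (fun _ : {ptws (set Z * set Y) -> R} => c).
  exact: cst_continuous.
have inS (S : set {ptws (set Z * set Y) -> R}) m : closed S -> coupling_set `<=` S ->
    closure coupling_set m -> S m.
  by move=> cS KS; rewrite closureE => /(_ S); apply.
have in0 (h : {ptws (set Z * set Y) -> R} -> R) m : continuous h ->
    (forall m', coupling_set m' -> h m' = 0) -> closure coupling_set m -> h m = 0.
  by move=> ch h0; apply: (inS [set m | h m = 0]) => //; exact: closed_coord.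
move=> m cm; split; first split.
- move=> p; apply/andP; split.
    apply: (inS [set m' : {ptws (set Z * set Y) -> R} | 0 <= m' p]) cm.
      by apply: (@closed_comp _ _ (fun m' : {ptws _
        -> R} => m' p : R) [set x | 0 <= x]) => [x _|]; [exact: cc|exact: closed_ge].
    by move=> m' [[/(_ p)/andP[]]].
  apply: (inS [set m' : {ptws (set Z * set Y) -> R} | m' p <= 1]) cm.
    by apply: (@closed_comp _ _ (fun m' : {ptws _ -> R} => m' p : R) [set x | x <= 1]) => [x _|];
      [exact: cc|exact: closed_le].
  by move=> m' [[/(_ p)/andP[]]].
- move=> A A' B mA mA' mB AA'.
  apply/eqP; rewrite -subr_eq0; apply/eqP.
  apply: (in0 (fun m' => m' (A `|` A', B) - (m' (A, B) + m' (A', B)))) cm.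
    exact: (cB _ _ (cc _) (cD _ _ (cc _) (cc _))).
  by move=> m' [[_ H _ _ _] _]; rewrite H// subrr.
- move=> A B B' mA mB mB' BB'.
  apply/eqP; rewrite -subr_eq0; apply/eqP.
  apply: (in0 (fun m' => m' (A, B `|` B') - (m' (A, B) + m' (A, B')))) cm.
    exact: (cB _ _ (cc _) (cD _ _ (cc _) (cc _))).
  by move=> m' [[_ _ H _ _] _]; rewrite H// subrr.
- move=> A mA; rewrite -(probability_fineK mu mA); congr EFin.
  apply/eqP; rewrite -subr_eq0; apply/eqP.
  apply: (in0 (fun m' => m' (A, setT) - fine (mu A))) cm.
    exact: (cB _ _ (cc _) (ck _)).
  by move=> m' [[_ _ _ H _] _]; rewrite -H//= subrr.
- move=> B mB; rewrite -(probability_fineK nu mB); congr EFin.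
  apply/eqP; rewrite -subr_eq0; apply/eqP.
  apply: (in0 (fun m' => m' (setT, B) - fine (nu B))) cm.
    exact: (cB _ _ (cc _) (ck _)).
  by move=> m' [[_ _ _ _ H] _]; rewrite -H//= subrr.
- move=> A B mA mB.
  apply/eqP; rewrite -subr_eq0; apply/eqP.
  apply: (in0 (fun m' => m' (f @^-1` A, g @^-1` B) - m' (A, B))) cm.
    exact: (cB _ _ (cc _) (cc _)).
  by move=> m' [_ H]; rewrite H// subrr.
Qed.

Lemma coupling_set_compact : compact coupling_set.
Proof.
apply: (subclosed_compact coupling_set_closed
  (tychonoff (fun p : set Z * set Y => @segment_compact R 0 1))).
by move=> m [[m01 _ _ _ _] _] p; rewrite /= in_itv/=.
Qed.

Hypotheses (eZ : ergodic mu f) (eY : ergodic nu g).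

(** An invariant event [C] of mass [a] is independent of each of the two systems, as they are
    ergodic. Hence adding or subtracting
    [del (A, B) = lam (C `&` (A `*` B)) - a * lam (A `*` B)] keeps the marginals, and the
    values in [[0, 1]] because [0 <= k <= min m a] and [m - k <= 1 - a] for the first term
    [k]. Extremality gives [del = 0]: the event [C] is independent of the rectangles, so of
    itself. *)
Lemma extreme_ergodic m : coupling_set m ->
  (forall m1 m2, coupling_set m1 -> coupling_set m2 -> midpoint m m1 m2 -> m1 = m2) ->
  exists lam : probability (Z * Y)%type R,
    ergodic_joining mu f nu g lam /\
    forall A B, measurable A -> measurable B -> lam (A `*` B) = (m (A, B))%:E.
Proof.
move=> [Hm minv] mext.
have [lam lamE] := coupling_of_precoupling Hm (aut_standard Z) (aut_standard Y).
have [m01 mUl mUr mmu mnu] := Hm.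
have mf : measurable_fun setT f := aut_measurable (S := Z).
have mg : measurable_fun setT g := aut_measurable (S := Y).
have mfg : measurable_fun setT (prod_map f g).
  by apply: measurable_fun_pair; [exact: measurableT_comp mf _|exact: measurableT_comp mg _].
have lam1 A : measurable A -> lam (fst @^-1` A) = mu A.
  move=> mA; rewrite (_ : fst @^-1` A = A `*` setT) ?lamE ?mmu//.
  by apply/seteqP; split => -[x y] //= [].
have lam2 B : measurable B -> lam (snd @^-1` B) = nu B.
  move=> mB; rewrite (_ : snd @^-1` B = setT `*` B) ?lamE ?mnu//.
  by apply/seteqP; split => -[x y] //= [].
have laminv C : measurable C -> lam (prod_map f g @^-1` C) = lam C.
  move=> mC; rewrite -(image_probE lam mfg); apply: rect_prob_unique mC => A B mA mB.
  rewrite image_probE (_ : _ @^-1` _ = (f @^-1` A) `*` (g @^-1` B))//.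
  by rewrite !lamE ?minv//; exact: measurable_preimage.
exists lam; split => //; split => // C mC Cinv.
pose a := fine (lam C).
have aE : a%:E = lam C by exact: probability_fineK.
have /andP[a0 a1] : 0 <= a <= 1 by exact: probability_fine01.
have indf A : measurable A -> lam (C `&` fst @^-1` A) = (a%:E * mu A)%E.
  move=> mA; rewrite aE.
  exact: (invariant_independent measurable_fst lam1 _ mfg laminv (aut_invertible Z) eZ mC Cinv).
have indg B : measurable B -> lam (C `&` snd @^-1` B) = (a%:E * nu B)%E.
  move=> mB; rewrite aE.
  exact: (invariant_independent measurable_snd lam2 _ mfg laminv (aut_invertible Y) eY mC Cinv).
pose k (p : set Z * set Y) := fine (lam (C `&` (p.1 `*` p.2))).
pose mable (p : set Z * set Y) := `[< measurable p.1 /\ measurable p.2 >].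
pose del (p : set Z * set Y) := if mable p then k p - a * m p else 0.
have delE A B : measurable A -> measurable B -> del (A, B) = k (A, B) - a * m (A, B).
  by move=> mA mB; rewrite /del /mable asboolT.
have mCR A B : measurable A -> measurable B -> measurable (C `&` (A `*` B)).
  by move=> mA mB; apply: measurableI => //; exact: measurableX.
have kE A B : measurable A -> measurable B -> (k (A, B))%:E = lam (C `&` (A `*` B)).
  by move=> mA mB; apply: probability_fineK; exact: mCR.
have k0 p : 0 <= k p by rewrite fine_ge0.
have kaU A A' B : measurable A -> measurable A' -> measurable B -> A `&` A' = set0 ->
    k (A `|` A', B) = k (A, B) + k (A', B).
  move=> mA mA' mB AA'; apply: EFin_inj; rewrite EFinD !kE//; last exact: measurableU.
  rewrite -measureU; try exact: mCR.
    congr (lam _); apply/seteqP; split => -[x y] /=.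
      by move=> [Cxy [[Ax|Ax] By]]; [left|right].
    by move=> [[Cxy [Ax By]]|[Cxy [Ax By]]]; split => //; split => //; [left|right].
  rewrite -subset0 => -[x y] /= [[_ [Ax _]] [_ [A'x _]]].
  by have : (A `&` A') x by []; rewrite AA'.
have kbU A B B' : measurable A -> measurable B -> measurable B' -> B `&` B' = set0 ->
    k (A, B `|` B') = k (A, B) + k (A, B').
  move=> mA mB mB' BB'; apply: EFin_inj; rewrite EFinD !kE//; last exact: measurableU.
  rewrite -measureU; try exact: mCR.
    congr (lam _); apply/seteqP; split => -[x y] /=.
      by move=> [Cxy [Ax [By|By]]]; [left|right].
    by move=> [[Cxy [Ax By]]|[Cxy [Ax By]]]; split => //; split => //; [left|right].
  rewrite -subset0 => -[x y] /= [[_ [_ Bx]] [_ [_ B'x]]].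
  by have : (B `&` B') y by []; rewrite BB'.
have kinv A B : measurable A -> measurable B -> k (f @^-1` A, g @^-1` B) = k (A, B).
  move=> mA mB; congr fine; rewrite -[RHS]laminv; last exact: mCR.
  by rewrite preimage_setI Cinv.
have km A B : measurable A -> measurable B -> k (A, B) <= m (A, B).
  move=> mA mB; rewrite -lee_fin kE// -lamE//; apply: le_measure; rewrite ?inE//.
    exact: mCR.
  exact: measurableX.
have ka A B : measurable A -> measurable B -> k (A, B) <= a.
  move=> mA mB; rewrite -lee_fin kE// aE; apply: le_measure; rewrite ?inE//.
  exact: mCR.
have kc A B : measurable A -> measurable B -> m (A, B) - k (A, B) <= 1 - a.
  move=> mA mB; have mR := measurableX mA mB; have mC' := measurableC mC.
  have : m (A, B) = k (A, B) + fine (lam ((A `*` B) `\` C)).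
    apply: EFin_inj; rewrite EFinD kE// probability_fineK; last exact: measurableD.
    by rewrite -lamE// (measureDI lam mR mC) addeC setIC.
  move=> ->; rewrite addrC addKr -lee_fin probability_fineK; last exact: measurableD.
  rewrite EFinB aE -probability_setC//; apply: le_measure; rewrite ?inE//.
  exact: measurableD.
have km_in (s : R) : s = 1 \/ s = -1 -> coupling_set (fun p => m p + s * del p).
  move=> s1; split; first split.
  - move=> p; have [/asboolP[mA mB]|np] := boolP (mable p); last first.
      by rewrite /del (negbTE np) mulr0 addr0.
    case: p mA mB => A B /= mA mB; rewrite delE//.
    have /andP[m0 m1] := m01 (A, B).
    have H1 := km _ _ mA mB; have H2 := ka _ _ mA mB; have H3 := kc _ _ mA mB; have H4 := k0 (A, B).
    by case: s1 => ->; apply/andP; split; nra.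
  - move=> A A' B mA mA' mB AA'; rewrite !delE//; last exact: measurableU.
    by rewrite kaU// mUl//; ring.
  - move=> A B B' mA mB mB' BB'; rewrite !delE//; last exact: measurableU.
    by rewrite kbU// mUr//; ring.
  - move=> A mA; rewrite delE// (_ : k (A, setT) = a * m (A, setT)) ?subrr ?mulr0 ?addr0 ?mmu//.
    apply: EFin_inj; rewrite kE// EFinM mmu// -indf//; congr (lam (_ `&` _)).
    by apply/seteqP; split => -[x y] //= [].
  - move=> B mB; rewrite delE// (_ : k (setT, B) = a * m (setT, B)) ?subrr ?mulr0 ?addr0 ?mnu//.
    apply: EFin_inj; rewrite kE// EFinM mnu// -indg//; congr (lam (_ `&` _)).
    by apply/seteqP; split => -[x y] //= [].
  - move=> A B mA mB; rewrite !delE//; try exact: measurable_preimage.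
    by rewrite kinv// minv.
have mE : (fun p => m p + 1 * del p) = (fun p => m p + (-1) * del p).
  apply: mext; [by apply: km_in; left|by apply: km_in; right|].
  by move=> p; field.
have kam A B : measurable A -> measurable B -> k (A, B) = a * m (A, B).
  by move=> mA mB; have := congr1 (fun F => F (A, B)) mE; rewrite delE// => H; lra.
pose m1 := mrestr lam mC; pose m2 := mscale (NngNum a0) lam.
have m1E S : m1 S = lam (S `&` C) by [].
have m2E S : m2 S = (a%:E * lam S)%E by [].
have m12 S : measurable S -> m1 S = m2 S.
  move=> mS; apply: (rect_measure_unique (m1 := m1) (m2 := m2)) => //.
    rewrite [X in (X < _)%E]m1E; apply: le_lt_trans (probability_le1 _ _) _; rewrite ?ltry//;
      exact: measurableI.
  move=> A B mA mB.
  suff : lam ((A `*` B) `&` C) = (a%:E * lam (A `*` B))%E by [].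
  by rewrite setIC -kE// kam// lamE.
have := m12 C mC; rewrite m1E m2E setIid -aE -EFinM => -[aa].
have : a * (1 - a) = 0 by rewrite mulrBr mulr1 -aa subrr.
move/eqP; rewrite mulf_eq0 subr_eq0 => /orP[/eqP ->|/eqP <-]; [by left|by right].
Qed.

Lemma ergodic_joining_above m0 A0 B0 : coupling_set m0 -> measurable A0 -> measurable B0 ->
  exists2 lam : probability (Z * Y)%type R,
    ergodic_joining mu f nu g lam & ((m0 (A0, B0))%:E <= lam (A0 `*` B0))%E.
Proof.
move=> K0 mA0 mB0.
have [m [Km m0m mext]] := exists_extreme_point coupling_set_compact coupling_set_closed (A0, B0) K0.
have [lam [elam lamE]] := extreme_ergodic Km mext.
by exists lam => //; rewrite lamE// lee_fin.
Qed.

End coupling_set.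

(** * Ergodic joinings of a system with joining primeness and a power *)

Lemma integral_restrict (R : realType) d (X : measurableType d) (mu : {measure set X -> \bar R})
  (A : set X) (h : X -> R) :
  (\int[mu]_(x in A) (h x)%:E = \int[mu]_x (h x * \1_A x)%:E)%E.
Proof.
rewrite integral_mkcond; apply: eq_integral => x _; rewrite patchE indicE.
by case: ifPn => _; rewrite ?mulr1 ?mulr0.
Qed.

Section density_product.
Context (R : realType) d e (X : measurableType d) (Y : measurableType e).
Context (mu : probability X R) (nu : probability Y R).

Lemma density_product_r (h : Y -> R) (q : set Y -> \bar R) (S : set (X * Y)) :
  measurable_fun setT h -> (forall y, 0 <= h y) ->
  (forall E, measurable E -> q E = \int[nu]_(y in E) (h y)%:E)%E -> measurable S ->
  (\int[(mu \x nu)]_(z in S) (h z.2)%:E = (mu \x q) S)%E.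
Proof.
move=> mh h0 qE mS; rewrite integral_restrict fubini_tonelli1/=; first last.
- by move=> z; rewrite lee_fin mulr_ge0.
- apply/measurable_EFinP; apply: measurable_funM; last exact: measurable_indic.
  exact: measurableT_comp mh _.
apply: eq_integral => x _; rewrite /fubini_F /= qE; last exact: measurable_xsection.
rewrite [RHS]integral_restrict; apply: eq_integral => y _ /=.
by rewrite !indicE mem_xsection.
Qed.

Lemma density_product_l (h : X -> R) (q : set X -> \bar R) (S : set (X * Y)) :
  measurable_fun setT h -> (forall y, 0 <= h y) ->
  (forall E, measurable E -> q E = \int[mu]_(y in E) (h y)%:E)%E -> measurable S ->
  (\int[(mu \x nu)]_(z in S) (h z.1)%:E = (q \x^ nu) S)%E.
Proof.
move=> mh h0 qE mS; rewrite integral_restrict fubini_tonelli2/=; first last.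
- by move=> z; rewrite lee_fin mulr_ge0.
- apply/measurable_EFinP; apply: measurable_funM; last exact: measurable_indic.
  exact: measurableT_comp mh _.
apply: eq_integral => y _; rewrite /fubini_G /= qE; last exact: measurable_ysection.
rewrite [RHS]integral_restrict; apply: eq_integral => x _ /=.
by rewrite !indicE mem_ysection.
Qed.

End density_product.


Section split.
Context (R : realType) d1 d2 d3 (Z : measurableType d1) (X : measurableType d2)
  (Y : measurableType d3).
Context (mu : probability X R) (nu : probability Y R)
  (lam : probability (Z * (X * Y))%type R) (B : set Z).
Hypothesis mB : measurable B.

Let mBT : measurable (B `*` setT : set (Z * (X * Y))).
Proof. exact: measurableX. Qed.

Lemma trace_density_unique (H : X * Y -> R) (m : {measure set (X * Y) -> \bar R}) :
  (forall S, measurable S -> m S = \int[(mu \x nu)]_(z in S) (H z)%:E)%E ->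
  (forall D E, measurable D -> measurable E -> lam (B `*` (D `*` E)) = m (D `*` E)) ->
  forall S, measurable S -> lam (B `*` S) = (\int[(mu \x nu)]_(z in S) (H z)%:E)%E.
Proof.
move=> mE HDE S mS; rewrite -mE//.
have trE S' : trace_image lam measurable_snd mBT S' = lam (B `*` S').
  by rewrite /trace_image; congr (lam _); apply/seteqP; split => -[z u] /=; tauto.
rewrite -trE; apply: (rect_measure_unique _ _ mS) => [|D E mD mE'].
  by rewrite [X in (X < _)%E]trE (le_lt_trans (probability_le1 _ _)) ?ltry.
by rewrite [LHS]trE; exact: HDE.
Qed.

(** In either alternative of joining primeness, for an event [B] of the first system, the
    measure [lam (B `*` _)] has a density that sees a single factor: the conditional
    density of [B] given that factor. *)
Lemma split_density_l (h : X -> R) :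
  measurable_fun setT h -> (forall y, 0 <= h y) ->
  (forall D, measurable D -> lam (B `*` (D `*` setT)) = \int[mu]_(y in D) (h y)%:E)%E ->
  (forall C : set ((Z * X) * Y), measurable C ->
     pushforward lam (fun w => ((w.1, w.2.1), w.2.2)) C =
     (pushforward lam (fun w => (w.1, w.2.1)) \x nu)%E C) ->
  forall S, measurable S ->
    lam (B `*` S) = (\int[(mu \x nu)]_(z in S) (h z.1)%:E)%E.
Proof.
move=> mh h0 hE J.
have m21 : measurable_fun setT (fun w : Z * (X * Y) => w.2.1).
  exact: (measurableT_comp measurable_fst measurable_snd).
have mk : measurable_fun setT (fun w : Z * (X * Y) => (w.1, w.2.1)).
  by apply: measurable_fun_pair.
pose q := trace_image lam m21 (measurable_preimage measurable_fst mB).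
have qE D : q D = lam (B `*` (D `*` setT)).
  by rewrite /q /trace_image; congr (lam _); apply/seteqP; split => -[z [x y]] /=; tauto.
apply: (trace_density_unique (m := (q \x^ nu)%E)) => [S mS|D E mD mE].
  by rewrite (@density_product_l _ _ _ _ _ mu nu h q)// => D mD; rewrite qE hE.
rewrite [RHS]product_measure2E//; rewrite [X in (X * _)%E]qE.
transitivity ((image_prob lam mk \x nu)%E ((B `*` D) `*` E)).
  rewrite -J; last by apply: measurableX => //; exact: measurableX.
  by rewrite /pushforward; congr (lam _); apply/seteqP; split => -[z [x y]] /=; tauto.
rewrite [LHS]product_measure1E//; last exact: measurableX.
suff -> : B `*` (D `*` [set: Y]) = (fun w => (w.1, w.2.1)) @^-1` (B `*` D) by [].
by apply/seteqP; split => -[z [x y]] /=; tauto.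
Qed.

Lemma split_density_r (h : Y -> R) :
  measurable_fun setT h -> (forall y, 0 <= h y) ->
  (forall D, measurable D -> lam (B `*` (setT `*` D)) = \int[nu]_(y in D) (h y)%:E)%E ->
  (forall C : set ((Z * Y) * X), measurable C ->
     pushforward lam (fun w => ((w.1, w.2.2), w.2.1)) C =
     (pushforward lam (fun w => (w.1, w.2.2)) \x mu)%E C) ->
  forall S, measurable S ->
    lam (B `*` S) = (\int[(mu \x nu)]_(z in S) (h z.2)%:E)%E.
Proof.
move=> mh h0 hE J.
have m22 : measurable_fun setT (fun w : Z * (X * Y) => w.2.2).
  exact: (measurableT_comp measurable_snd measurable_snd).
have mk : measurable_fun setT (fun w : Z * (X * Y) => (w.1, w.2.2)).
  by apply: measurable_fun_pair.
pose q := trace_image lam m22 (measurable_preimage measurable_fst mB).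
have qE D : q D = lam (B `*` (setT `*` D)).
  by rewrite /q /trace_image; congr (lam _); apply/seteqP; split => -[z [x y]] /=; tauto.
have qfin : fin_num_fun q by exact: fin_num_measure.
pose q' : {finite_measure set Y -> \bar R} := q.
apply: (trace_density_unique (m := (mu \x q')%E)) => [S mS|D E mD mE].
  by rewrite (@density_product_r _ _ _ _ _ mu nu h q')// => D mD; rewrite [LHS]qE hE.
rewrite [RHS]product_measure1E//; rewrite [X in (_ * X)%E]qE.
transitivity ((image_prob lam mk \x mu)%E ((B `*` E) `*` D)).
  rewrite -J; last by apply: measurableX => //; exact: measurableX.
  by rewrite /pushforward; congr (lam _); apply/seteqP; split => -[z [x y]] /=; tauto.
rewrite [LHS]product_measure1E//; last exact: measurableX.
rewrite muleC.
suff -> : B `*` ([set: X] `*` E) = (fun w => (w.1, w.2.2)) @^-1` (B `*` E) by [].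
by apply/seteqP; split => -[z [x y]] /=; tauto.
Qed.

End split.

Section one_coordinate.
Context (R : realType) (Z S : automorphism R).
Local Notation rho := (aut_measure Z).
Local Notation nu := (aut_measure S).
Local Notation g := (aut_map S).

(** The constant case is separate because there is no coordinate when [n = 0]. *)
Definition one_coordinate n (H : n.-tuple S -> R) : Prop :=
  (exists2 c, 0 <= c <= 1 & H = fun=> c) \/
  exists i (h : S -> R), [/\ measurable_fun setT h, forall y, 0 <= h y <= 1 &
    H = fun t => h (tnth t i)].

Lemma one_coordinate_measurable n (H : n.-tuple S -> R) :
  one_coordinate H -> measurable_fun setT H.
Proof.
move=> [[c _ ->]|[i [h [mh _ ->]]]]; first exact: measurable_cst.
exact: measurableT_comp mh (measurable_tnth i).
Qed.

Lemma one_coordinate_ge0 n (H : n.-tuple S -> R) : one_coordinate H -> forall t, 0 <= H t.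
Proof. by move=> [[c /andP[c0 _] ->]|[i [h [_ h01 ->]]]] t //; case/andP: (h01 (tnth t i)). Qed.

Hypotheses (jpZ : joining_primeness Z) (wS : weakly_mixing nu g).

(** By induction on [n], with [S^n.+1] viewed as [S * S^n]. If [S^n] is independent of
    the pair [(Z, S)], the density depends on the first coordinate; if [S] is independent of
    the pair [(Z, S^n)], the induction hypothesis applies to the projection to [Z * S^n]. *)
Lemma jp_power n (lam : probability (Z * n.-tuple S)%type R) :
  ergodic_joining rho (aut_map Z) (power_measure nu n) (power_map n g) lam ->
  forall B, measurable B -> exists2 H, one_coordinate H &
  forall A, measurable A -> lam (B `*` A) = (\int[power_measure nu n]_(t in A) (H t)%:E)%E.
Proof.
elim: n lam => [|n IH] lam [[lam1 lam2 laminv] elam] B mB.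
  have mBT : measurable (B `*` [set: 0.-tuple S]) by exact: measurableX.
  exists (fun=> fine (lam (B `*` setT))).
    by left; exists (fine (lam (B `*` setT))) => //; exact: probability_fine01.
  move=> A mA; have [->|/set0P[t At]] := eqVneq A set0.
    by rewrite setX0 integral_set0 measure0.
  have -> : A = setT.
    by apply/seteqP; split => // u _; rewrite (tuple0 u); move: At; rewrite (tuple0 t).
  rewrite integral_cst// -[LHS]mule1; congr (_ * _)%E; first by rewrite probability_fineK.
  exact/esym/probability_setT.
pose Y := aut_space S.
pose th (w : Z * n.+1.-tuple Y) : Z * (Y * n.-tuple Y) := (w.1, tuple_uncons w.2).
have mth : measurable_fun setT th.
  apply: measurable_fun_pair; first exact: measurable_fst.
  exact: (measurableT_comp (@measurable_tuple_uncons _ Y n) measurable_snd).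
pose lam' := image_prob lam mth.
pose F := prod_map (aut_map Z) (prod_map g (power_map n g)).
have thF w : th (prod_map (aut_map Z) (power_map n.+1 g) w) = F (th w).
  case: w => z t; congr (_, _).
  change (tuple_uncons (power_map n.+1 g t) = prod_map g (power_map n g) (tuple_uncons t)).
  by rewrite -[X in power_map _ _ X](tuple_unconsK t) power_map_cons tuple_consK.
have mF : measurable_fun setT F.
  have mg := aut_measurable (S := S); have mpg := measurable_power_map (n := n) mg.
  apply: measurable_fun_pair; first exact: measurableT_comp (aut_measurable (S := Z)) _.
  apply: (measurableT_comp _ measurable_snd).
  by apply: measurable_fun_pair; [exact: measurableT_comp mg _|exact: measurableT_comp mpg _].
have lam'1 A : measurable A -> lam' (fst @^-1` A) = rho A by move=> mA; rewrite -lam1.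
have lam'2 A : measurable A -> lam' (snd @^-1` A) = (nu \x power_measure nu n)%E A.
  move=> mA; rewrite /lam' image_probE.
  have mu' := @measurable_tuple_uncons _ Y n.
  transitivity (lam (snd @^-1` (@tuple_uncons _ Y n @^-1` A))) => //.
  rewrite lam2; last exact: measurable_preimage.
  rewrite /= /distribution /pushforward -comp_preimage.
  by rewrite (_ : _ \o _ = id)//; apply/funext => z /=; rewrite tuple_consK.
have lam'inv C : measurable C -> lam' (F @^-1` C) = lam' C.
  move=> mC; transitivity (lam (prod_map (aut_map Z) (power_map n.+1 g) @^-1` (th @^-1` C))).
    suff -> : prod_map (aut_map Z) (power_map n.+1 g) @^-1` (th @^-1` C) = th @^-1`
      (F @^-1` C) by [].
    by apply/funext => w; rewrite /preimage /mkset thF.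
  by apply: laminv; exact: measurable_preimage.
have elam' : ergodic lam' F.
  by apply: (ergodic_factor mth _ thF elam) => A mA; rewrite /lam' image_probE.
have jl' : ergodic_joining rho (aut_map Z) (nu \x power_measure nu n)%E
    (prod_map g (power_map n g)) lam' by [].
have S2w := power_weakly_mixing (n := n) wS.
(* It is enough to find the density on pairs. *)
have final (H : Y * n.-tuple Y -> R) : measurable_fun setT H -> (forall z, 0 <= H z) ->
    (forall S', measurable S' -> lam' (B `*` S') = \int[(nu \x power_measure nu n)]_(z in S')
      (H z)%:E)%E ->
    forall A, measurable A -> lam (B `*` A) =
      (\int[power_measure nu n.+1]_(t in A) (H (tuple_uncons t))%:E)%E.
  move=> mH H0 HE A mA.
  have mcA : measurable (@tuple_cons _ Y n @^-1` A).
    by apply: measurable_preimage mA; exact: measurable_tuple_cons.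
  have mu' := @measurable_tuple_uncons _ Y n.
  have nuE (E : set (Y * n.-tuple Y)) : measurable E ->
      power_measure nu n.+1 (@tuple_uncons _ Y n @^-1` E) = (nu \x power_measure nu n)%E E.
    move=> mE; rewrite /= /distribution /pushforward -comp_preimage.
    by rewrite (_ : _ \o _ = id)//; apply/funext => z /=; rewrite tuple_consK.
  transitivity (lam' (B `*` (@tuple_cons _ Y n @^-1` A))).
    rewrite /lam' image_probE; congr (lam _).
    by apply/seteqP; split => -[z t] /=; rewrite tuple_unconsK.
  rewrite HE// (integral_image mu' nuE mcA); first last.
  - by move=> z; rewrite lee_fin.
  - exact/measurable_EFinP.
  by rewrite -comp_preimage (_ : _ \o _ = id)//; apply/funext => z /=; rewrite tuple_unconsK.
have [J|J] := jpZ.2 S (power_automorphism S n) wS S2w lam' jl'.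
- have m21 : measurable_fun setT (fun w : Z * (Y * n.-tuple Y) => w.2.1).
    exact: (measurableT_comp measurable_fst measurable_snd).
  have mE : measurable (fst @^-1` B : set (Z * (Y * n.-tuple Y))).
    exact: measurable_preimage measurable_fst mB.
  have law21 D : measurable D -> lam' ((fun w => w.2.1) @^-1` D) = nu D.
    move=> mD; rewrite (_ : _ @^-1` D = snd @^-1` (D `*` setT)); last first.
      by apply/seteqP; split => -[z [y t]] //= [].
    rewrite lam'2; last exact: measurableX.
    rewrite product_measure1E// -[RHS]mule1; congr (_ * _)%E.
    exact: probability_setT.
  have [h [mh h01 hE]] := conditional_density m21 mE law21.
  have h0 y : 0 <= h y by case/andP: (h01 y).
  exists (fun t => h (tnth t ord0)); first by right; exists ord0, h.
  move=> A mA; rewrite (final (fun z => h z.1))//; first exact: measurableT_comp mh measurable_fst.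
  apply: (split_density_l mB mh h0 _ J) => D mD; rewrite -hE//; congr (lam' _).
  by apply/seteqP; split => -[z [x y]] /=; tauto.
- pose k (w : Z * (Y * n.-tuple Y)) := (w.1, w.2.2).
  have mk : measurable_fun setT k.
    apply: measurable_fun_pair; first exact: measurable_fst.
    exact: (measurableT_comp measurable_snd measurable_snd).
  have P2j : ergodic_joining rho (aut_map Z) (power_measure nu n) (power_map n g)
      (image_prob lam' mk).
    split; first split => [A mA|E mE|C mC].
    + by rewrite image_probE -(lam'1 _ mA).
    + rewrite image_probE (_ : _ @^-1` _ = snd @^-1` (setT `*` E)); last first.
        by apply/seteqP; split => -[z [y t]] //= [].
      rewrite lam'2; last exact: measurableX.
      rewrite product_measure1E// -[RHS]mul1e; congr (_ * _)%E.
      exact: probability_setT.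
    + by apply: (lam'inv (k @^-1` C)); exact: measurable_preimage.
    + by apply: (ergodic_factor mk _ _ elam') => // A mA; rewrite image_probE.
  have [H' H'1 H'E] := IH _ P2j B mB.
  exists (fun t => H' (tuple_uncons t).2).
    case: H'1 => [[c c01 ->]|[i [h [mh h01 ->]]]]; first by left; exists c.
    right; exists (lift ord0 i), h; split => //; apply/funext => t.
    by rewrite -[X in tnth X (lift _ _)](tuple_unconsK t) /tuple_cons tnthS.
  have mH' := one_coordinate_measurable H'1; have H'0 := one_coordinate_ge0 H'1.
  move=> A mA; rewrite (final (fun z => H' z.2))//;
    first exact: measurableT_comp mH' measurable_snd.
  apply: (split_density_r mB mH' H'0 _ J) => D mD; rewrite -H'E// image_probE; congr (lam' _).
  by apply/seteqP; split => -[z [x y]] /=; tauto.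
Qed.


End one_coordinate.

(** * One coordinate and a nearly symmetric event *)

Lemma integral_abs_le_norm2 (R : realType) d (X : measurableType d) (P : probability X R)
  (u : X -> R) : measurable_fun setT u ->
  (\int[P]_x `|u x|%:E <= 'N[P]_2%:E[EFin \o u])%E.
Proof.
move=> mu.
have H := @hoelder _ _ _ P u (cst 1) 2 2 mu (measurable_cst _).
have {H} := H (ltr0Sn _ _) (ltr0Sn _ _) (esym (etrans (splitr 1) (congr2 +%R (div1r _) (div1r _)))).
have -> : ('N[P]_2%:E[EFin \o cst 1%R] = 1)%E.
  have -> : EFin \o cst 1%R = cst 1%E :> (X -> \bar R) by [].
  by rewrite Lnorm_cst1 [X in (X `^ _)%E]probability_setT poweR1r.
rewrite mule1 Lnorm1; apply: le_trans.
by under [leRHS]eq_integral => x _ do rewrite /= mulr1.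
Qed.

Lemma Lfun_indic (R : realType) d (X : measurableType d) (P : probability X R) (A : set X) :
  measurable A -> (\1_A : X -> R) \in Lfun P 2%:E.
Proof.
move=> mA.
rewrite inE; apply/andP; split; rewrite inE/=; first exact: measurable_indic.
rewrite /finite_norm unlock poweR_lty//.
apply: (@le_lt_trans _ _ (\int[P]_x (cst 1%E x)))%E; last first.
  by rewrite integral_cst// mul1e (le_lt_trans (probability_le1 _ _))// ltry.
apply: ge0_le_integral => //.
- by move=> t _; rewrite poweR_ge0.
- apply/measurable_EFinP.
  apply/(@measurableT_comp _ _ _ _ _ _ (fun x : R => x `^ 2)%R) => //.
  by apply: measurableT_comp => //; exact: measurable_indic.
- move=> t _ /=; rewrite indicE; case: (t \in A); rewrite ?normr1 ?normr0 ?powR1 ?powR0//.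

Qed.

Section symmetric.
Context (R : realType) d (Y : measurableType d) (nu : probability Y R).

Lemma measurable_permute_coord n (s : 'S_n) : measurable_fun setT (@permute_coord d Y n s).
Proof.
apply/measurable_fun_tnthP => i.
rewrite (_ : _ \o _ = fun t => tnth t (s i)); first exact: measurable_tnth.
by apply/funext => t /=; rewrite tnth_mktuple.
Qed.

Lemma measurable_box n (A : 'I_n -> set Y) : (forall i, measurable (A i)) ->
  measurable [set t : n.-tuple Y | forall i, A i (tnth t i)].
Proof.
move=> mA; rewrite (_ : [set t | _] =
    \bigcap_(i in [set: 'I_n]) ((fun t => tnth t i) @^-1` A i)).
  apply: fin_bigcap_measurable; first exact: finite_finset.
  by move=> i _; apply: measurable_preimage (mA i); exact: measurable_tnth.
by apply/seteqP; split=> t /= tA i => [_|]; exact: tA.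
Qed.

Lemma box_measure_unique n (m1 m2 : {measure set (n.-tuple Y) -> \bar R}) :
  (m1 setT < +oo)%E ->
  (forall A : 'I_n -> set Y, (forall i, measurable (A i)) ->
     m1 [set t | forall i, A i (tnth t i)] = m2 [set t | forall i, A i (tnth t i)]) ->
  forall C, measurable C -> m1 C = m2 C.
Proof.
move=> m1T m12 C mC.
pose G : set (set (n.-tuple Y)) :=
  [set B | exists2 A : 'I_n -> set Y, forall i, measurable (A i) &
    B = [set t | forall i, A i (tnth t i)]].
apply: (measure_unique G (fun=> setT)) => //.
- apply/seteqP; split.
    apply: sub_smallest2r; first exact: smallest_sigma_algebra.
    elim/big_ind : _ => [//|U V UG VG|i _ B [A mA <-]]; first by rewrite subUset.
    exists (fun j => if j == i then A else setT) => [j|]; first by case: ifP.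
    apply/seteqP; split => t /=.
      by move=> [_ At] j; case: eqP => [->|].
    by move=> /(_ i); rewrite eqxx.
  apply: smallest_sub; first exact: sigma_algebra_measurable.
  by move=> _ [A mA ->]; exact: measurable_box.
- move=> _ _ [A mA ->] [B mB ->]; exists (fun i => A i `&` B i).
    by move=> i; exact: measurableI.
  by apply/seteqP; split => t /=; [move=> [h1 h2] i; split|move=> h; split=> i; have [] := h i].
- by move=> _; exists (fun=> setT) => //; apply/seteqP; split.
- by rewrite bigcup_const.
- by move=> _ [A mA ->]; exact: m12.
Qed.

Lemma power_measure_permute n (s : 'S_n) A : measurable A ->
  power_measure nu n (permute_coord s @^-1` A) = power_measure nu n A.
Proof.
move=> mA; transitivity (image_prob (power_measure nu n) (measurable_permute_coord s) A) => //.
apply: box_measure_unique mA => [|B mB].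
  by rewrite (le_lt_trans (probability_le1 _ _)) ?ltry.
rewrite [RHS]power_measureE//.
transitivity (power_measure nu n [set t | forall i, B ((s^-1)%g i) (tnth t i)]).
  suff -> : [set t : n.-tuple Y | forall i, B ((s^-1)%g i) (tnth t i)] =
    permute_coord s @^-1` [set t | forall i, B i (tnth t i)] by [].
  apply/seteqP; split => t /= h i; last first.
    by have := h ((s^-1)%g i); rewrite tnth_mktuple permKV.
  by have := h (s i); rewrite permK tnth_mktuple.
rewrite (@power_measureE _ _ _ nu n (fun j => B ((s^-1)%g j)) (fun j => mB _)).
by rewrite [RHS](reindex_inj (@perm_inj _ (s^-1)%g)).
Qed.

Lemma measurable_coord n (h : Y -> R) (i : 'I_n) : measurable_fun setT h ->
  measurable_fun setT (fun t : n.-tuple Y => h (tnth t i)).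
Proof. by move=> mh; exact: measurableT_comp mh (measurable_tnth i). Qed.

Lemma integral_coord n (h : Y -> R) (i : 'I_n) : measurable_fun setT h -> (forall y, 0 <= h y) ->
  (\int[power_measure nu n]_t (h (tnth t i))%:E = \int[nu]_y (h y)%:E)%E.
Proof.
move=> mh h0; rewrite (integral_image (theta := fun t : n.-tuple Y => tnth t i)
  (P := power_measure nu n))//.
- exact: measurable_tnth.
- move=> A mA; pose B (j : 'I_n) := if j == i then A else setT.
  transitivity (power_measure nu n [set t | forall j, B j (tnth t j)]).
    congr (power_measure nu n _); apply/seteqP; split => t /=.
      by move=> At j; rewrite /B; case: eqP => [->|].
    by move=> /(_ i); rewrite /B eqxx.
  rewrite power_measureE => [|j]; last by rewrite /B; case: ifP.
  rewrite (bigD1 i)//= /B eqxx big1 ?mule1// => j /negbTE ->.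
  exact: probability_setT.
- exact/measurable_EFinP.
Qed.

Lemma deviation_square_step (h : Y -> R) (c b : R) : measurable_fun setT h ->
  (forall y, 0 <= h y <= 1) -> (\int[nu]_y (h y)%:E = c%:E)%E ->
  (\int[nu]_y ((b + (h y - c)) ^+ 2)%:E <= (b ^+ 2 + 1)%:E)%E.
Proof.
move=> mh h01 hc.
have ih : nu.-integrable setT (EFin \o h).
  apply/integrableP; split; first exact/measurable_EFinP.
  rewrite (_ : integral _ _ _ = c%:E) ?ltry// -hc; apply: eq_integral => y _.
  by rewrite gee0_abs ?lee_fin//; case/andP: (h01 y).
have c01 : 0 <= c <= 1.
  rewrite -!lee_fin -hc integral_ge0/=; last by move=> y _; rewrite lee_fin; case/andP: (h01 y).
  rewrite -[leRHS](_ : \int[nu]_y (cst 1%E y) = 1)%E.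
    apply: ge0_le_integral => //.
    - by move=> y _; rewrite lee_fin; case/andP: (h01 y).
    - exact/measurable_EFinP.
    - by move=> y _; rewrite lee_fin; case/andP: (h01 y).
  by rewrite integral_cst// mul1e; exact: probability_setT.
pose k := b ^+ 2 + 1 - 2 * b * c.
have ik : nu.-integrable setT (EFin \o cst k).
  by apply: finite_measure_integrable_cst.
have iz : nu.-integrable setT (fun y => (2 * b)%:E * (h y)%:E)%E by exact: integrableZl.
apply: (@le_trans _ _ (\int[nu]_y ((EFin \o cst k) y + (2 * b)%:E * (h y)%:E))%E); last first.
  rewrite integralD//= integralZl// hc integral_cst// [X in (_ * X + _)%E]probability_setT mule1.
  by rewrite -EFinM -EFinD lee_fin /k; lra.
apply: ge0_le_integral => //.
- by move=> y _; rewrite lee_fin sqr_ge0.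
- apply/measurable_EFinP; apply: measurable_funX; apply: measurable_funD => //.
  exact: measurable_funB.
- by apply: emeasurable_funD; [exact: measurable_int ik|exact: measurable_int iz].
- by move=> y _; rewrite -EFinM -EFinD lee_fin /k/=; have := h01 y; nra.
Qed.

(** The variance of a sum of independent variables. The free constant [b] makes the induction
    work with nonnegative integrals only: it absorbs the first coordinate, and its cross
    term vanishes when that coordinate is integrated. *)
Lemma deviation_square n (h : Y -> R) (c b : R) : measurable_fun setT h ->
  (forall y, 0 <= h y <= 1) -> (\int[nu]_y (h y)%:E = c%:E)%E ->
  (\int[power_measure nu n]_t ((b + \sum_(i < n) (h (tnth t i) - c)) ^+ 2)%:E
     <= (b ^+ 2 + n%:R)%:E)%E.
Proof.
move=> mh h01 hc; elim: n b => [|n IH] b.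
  under eq_integral do rewrite big_ord0 addr0.
  by rewrite addr0 integral_cst// [X in (_ * X <= _)%E]probability_setT mule1.
have msum m : measurable_fun setT (fun t : m.-tuple Y => b + \sum_(i < m) (h (tnth t i) - c)).
  apply: measurable_funD => //; apply: measurable_sum => i.
  by apply: measurable_funB => //; exact: measurable_coord.
have msq m : measurable_fun setT (fun t : m.-tuple Y => ((b + \sum_(i < m) (h
  (tnth t i) - c)) ^+ 2)%:E).
  by apply/measurable_EFinP; apply: measurable_funX; exact: msum.
rewrite (integral_image (theta := @tuple_cons _ Y n) (P := (nu \x power_measure nu n)%E))//;
  first last.
- by move=> t; rewrite lee_fin sqr_ge0.
- exact: msq.
rewrite preimage_setT fubini_tonelli1/=; first last.
- by move=> t; rewrite lee_fin sqr_ge0.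
- exact: measurableT_comp (msq n.+1) (@measurable_tuple_cons _ Y n).
apply: (@le_trans _ _ (\int[nu]_y ((b + (h y - c)) ^+ 2 + n%:R)%:E)%E).
  apply: ge0_le_integral => //.
  - by move=> y _; apply: integral_ge0 => t _; rewrite lee_fin sqr_ge0.
  - apply: measurable_fun_fubini_tonelli_F => [|z]; last by rewrite lee_fin sqr_ge0.
    exact: measurableT_comp (msq n.+1) (@measurable_tuple_cons _ Y n).
  - apply/measurable_EFinP; apply: measurable_funD => //; apply: measurable_funX.
    by apply: measurable_funD => //; exact: measurable_funB.
  - move=> y _; rewrite /fubini_F; apply: le_trans (IH (b + (h y - c))).
    rewrite le_eqVlt; apply/orP; left; apply/eqP; apply: eq_integral => t _.
    rewrite big_ord_recl tnth0 addrA (eq_bigr (fun i => h (tnth t i) - c))// => i _.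
    by rewrite tnthS.
under eq_integral do rewrite EFinD.
rewrite ge0_integralD//=; first last.
- apply/measurable_EFinP; apply: measurable_funX.
  by apply: measurable_funD => //; exact: measurable_funB.
- by move=> y _; rewrite lee_fin sqr_ge0.
rewrite integral_cst// [X in (_ + _ * X)%E]probability_setT mule1.
apply: (@le_trans _ _ ((b ^+ 2 + 1)%:E + n%:R%:E)%E).
  by rewrite leeD2r// deviation_square_step.
by rewrite -EFinD lee_fin -addrA lerD2l -natr1 addrC.
Qed.

(** The transposition of [i] and [j] exchanges the two coordinates and moves the indicator of
    [A] by at most [2 * e] in [L1], since [s] is fixed by it. *)
Lemma swap_coordinate n (A : set (n.-tuple Y)) (s : n.-tuple Y -> R) (h : Y -> R) (e : R)
  (i j : 'I_n) :
  measurable A -> measurable_fun setT s -> (forall (p : 'S_n) t, s (permute_coord p t) = s t) ->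
  (\int[power_measure nu n]_t `|\1_A t - s t|%:E <= e%:E)%E ->
  measurable_fun setT h -> (forall y, 0 <= h y <= 1) ->
  (\int[power_measure nu n]_(t in A) (h (tnth t i))%:E
     <= \int[power_measure nu n]_(t in A) (h (tnth t j))%:E + (2 * e)%:E)%E.
Proof.
move=> mA ms sp se mh h01; pose th := @permute_coord _ Y n (tperm i j).
have mth : measurable_fun setT th := @measurable_permute_coord n (tperm i j).
have thE B : measurable B -> power_measure nu n (th @^-1` B) = power_measure nu n B.
  exact: power_measure_permute.
have h0 y : 0 <= h y by case/andP: (h01 y).
have mi k : measurable_fun setT (fun t : n.-tuple Y => (h (tnth t k))%:E).
  by apply/measurable_EFinP; exact: measurable_coord.
have mD : measurable_fun setT (fun t => `|\1_A t - s t|).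
  by apply: measurableT_comp => //; apply: measurable_funB => //; exact: measurable_indic.
have mDE : measurable_fun setT (fun t => `|\1_A t - s t|%:E) by exact/measurable_EFinP.
have mDth : measurable_fun setT (fun t => `|\1_A (th t) - s (th t)|%:E).
  exact: measurableT_comp mDE mth.
have mA' : measurable (th @^-1` A) by exact: measurable_preimage.
have mI : measurable_fun setT (fun t => (h (tnth t i) * \1_(th @^-1` A) t)%:E).
  apply/measurable_EFinP; apply: measurable_funM; last exact: measurable_indic.
  exact: measurable_coord.
have D0 t : (0 <= `|\1_A t - s t|%:E)%E by rewrite lee_fin.
have De : (\int[power_measure nu n]_t `|\1_A (th t) - s (th t)|%:E <= e%:E)%E.
  by rewrite -(integral_image mth thE measurableT mDE D0).
have -> : (\int[power_measure nu n]_(t in A) (h (tnth t j))%:E =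
    \int[power_measure nu n]_t (h (tnth t i) * \1_(th @^-1` A) t)%:E)%E.
  rewrite -integral_restrict (integral_image mth thE mA (mi j)) => [|t]; last by rewrite lee_fin.
  by apply: eq_integral => t _; rewrite tnth_mktuple tpermR.
rewrite integral_restrict mulrDl mul1r.
apply: (@le_trans _ _ (\int[power_measure nu n]_t
   ((h (tnth t i) * \1_(th @^-1` A) t)%:E +
    (`|\1_A t - s t|%:E + `|\1_A (th t) - s (th t)|%:E)))%E); last first.
  rewrite ge0_integralD//; first last.
  - exact: emeasurable_funD.
  - by move=> t _; rewrite adde_ge0.
  - by move=> t _; rewrite lee_fin mulr_ge0.
  by rewrite leeD2l// ge0_integralD// EFinD leeD.
apply: ge0_le_integral => //.
- by move=> t _; rewrite lee_fin mulr_ge0.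
- apply/measurable_EFinP; apply: measurable_funM; last exact: measurable_indic.
  exact: measurable_coord.
- by apply: emeasurable_funD => //; exact: emeasurable_funD.
- move=> t _; rewrite -!EFinD lee_fin sp !indicE.
  have -> : (t \in th @^-1` A) = (th t \in A) by apply/idP/idP; rewrite !inE.
  have := h01 (tnth t i); case: (t \in A); case: (th t \in A) => /= /andP[a b].
  + by rewrite lerDl addr_ge0.
  + rewrite mulr1 mulr0 add0r (le_trans b)//.
    have := ler_normB (1 - s t) (0 - s t).
    by rewrite opprB addrA subrK subr0 normr1.
  + by rewrite mulr0 mulr1 !addr_ge0.
  + by rewrite !mulr0 add0r addr_ge0.
Qed.

(** The integrals over [A] of the [h (tnth t j)] are within [2 * e] of one another, so the
    given one is compared with their average. The sum of the [h (tnth t j) - c] is a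
    variable [W] with second moment at most [n], and [W <= (W ^+ 2 / r + r) / 2] for
    [r = sqrt n] bounds its integral over any event by [sqrt n]. *)
Lemma symmetric_coordinate_bound n (A : set (n.-tuple Y)) (s : n.-tuple Y -> R) (h : Y -> R)
  (c e : R)
  (i : 'I_n) :
  measurable A -> measurable_fun setT s -> (forall (p : 'S_n) t, s (permute_coord p t) = s t) ->
  (\int[power_measure nu n]_t `|\1_A t - s t|%:E <= e%:E)%E ->
  measurable_fun setT h -> (forall y, 0 <= h y <= 1) ->
  (\int[nu]_y (h y)%:E = c%:E)%E ->
  (\int[power_measure nu n]_(t in A) (h (tnth t i))%:E
     <= (c * fine (power_measure nu n A) + (Num.sqrt n%:R)^-1 + 2 * e)%:E)%E.
Proof.
move=> mA ms sp se mh h01 hc; have n0 : (0 < n)%N by case: n i {A s mA ms sp se} => // -[].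
pose P := power_measure nu n; pose r : R := Num.sqrt n%:R.
have r0 : 0 < r by rewrite sqrtr_gt0 ltr0n.
have rr : r * r = n%:R by rewrite -expr2 sqr_sqrtr.
have r20 : 0 <= r / 2 by rewrite divr_ge0// ltW.
have ri20 : 0 <= r^-1 / 2 by rewrite divr_ge0// invr_ge0 ltW.
have h0 y : 0 <= h y by case/andP: (h01 y).
have mi k : measurable_fun setT (fun t : n.-tuple Y => (h (tnth t k))%:E).
  by apply/measurable_EFinP; exact: measurable_coord.
pose I k := (\int[P]_(t in A) (h (tnth t k))%:E)%E.
have I1 k : (0 <= I k <= 1)%E.
  rewrite integral_ge0/= => [|t _]; last by rewrite lee_fin.
  apply: (@le_trans _ _ (P A)); last exact: probability_le1.
  rewrite -[leRHS]mul1e -integral_cst//; apply: ge0_le_integral => //.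
  - by move=> t _; rewrite lee_fin.
  - exact: measurable_funTS.
  - by move=> t _; rewrite lee_fin; case/andP: (h01 (tnth t k)).
have IE k : I k = (fine (I k))%:E.
  have /andP[a b] := I1 k; rewrite fineK// fin_numElt (lt_le_trans _ a) ?ltNyr//.
  by rewrite (le_lt_trans b) ?ltry.
pose p := fine (P A); have pE : P A = p%:E by rewrite /p probability_fineK.
have c0 : 0 <= c by rewrite -lee_fin -hc integral_ge0// => y _; rewrite lee_fin.
pose W (t : n.-tuple Y) := \sum_(j < n) (h (tnth t j) - c).
have mW : measurable_fun setT (fun t => W t ^+ 2).
  apply: measurable_funX; apply: measurable_sum => j.
  by apply: measurable_funB => //; exact: measurable_coord.
have sumI : (\sum_(j < n) fine (I j) <= n%:R * c * p + r).
  rewrite -lee_fin -sumEFin.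
  under eq_bigr => j _ do rewrite -IE.
  rewrite /I -ge0_integral_sum//; last 2 first.
  - by move=> j; exact: measurable_funTS.
  - by move=> j t _; rewrite lee_fin.
  rewrite integral_mkcond.
  apply: (@le_trans _ _ (\int[P]_t ((n%:R * c * \1_A t)%:E + (r^-1 / 2 * W t ^+ 2 + r / 2)%:E))%E).
    apply: ge0_le_integral => //.
    - move=> t _; rewrite patchE; case: ifPn => // _; apply: sume_ge0 => j _.
      by rewrite lee_fin.
    - apply/(measurable_restrict _ _ _) => //.
      by apply: emeasurable_sum => j; exact: measurable_funTS.
    - apply: emeasurable_funD; apply/measurable_EFinP.
        by apply: measurable_funM => //; exact: measurable_indic.
      by apply: measurable_funD => //; exact: measurable_funM.
    - move=> t _; rewrite patchE indicE -EFinD.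
      have W2 : W t <= r^-1 / 2 * W t ^+ 2 + r / 2.
        have := sqr_ge0 (W t - r); rewrite sqrrB -(ler_pM2l (_ : 0 < r^-1 / 2)); last first.
          by rewrite divr_gt0// invr_gt0.
        rewrite mulr0 => H; rewrite -subr_ge0; apply: (le_trans H).
        rewrite le_eqVlt; apply/orP; left; apply/eqP; field; exact: lt0r_neq0.
      case: ifPn => _; last first.
        change (0%:E <= (n%:R * c * false%:R + (r^-1 / 2 * W t ^+ 2 + r / 2))%:E)%E.
        by rewrite lee_fin mulr0 add0r addr_ge0// mulr_ge0// sqr_ge0.
      rewrite sumEFin lee_fin mulr1.
      have -> : \sum_(j < n) h (tnth t j) = n%:R * c + W t.
        by rewrite /W sumrB sumr_const card_ord -[c *+ n]mulr_natl addrC subrK.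
      by rewrite lerD2l.
  rewrite ge0_integralD//; first last.
  - by apply/measurable_EFinP; apply: measurable_funD => //; exact: measurable_funM.
  - by move=> t _; rewrite lee_fin addr_ge0// mulr_ge0// sqr_ge0.
  - by apply/measurable_EFinP; apply: measurable_funM => //; exact: measurable_indic.
  - by move=> t _; rewrite lee_fin !mulr_ge0.
  rewrite EFinD; apply: leeD.
    rewrite (_ : integral _ _ _ = \int[P]_(x in A) (cst (n%:R * c)%:E x))%E; last first.
      by rewrite (integral_restrict P A (fun=> n%:R * c)).
    rewrite integral_cst//.
    by rewrite [X in (_ * X)%E]pE -EFinM lee_fin.
  under eq_integral do rewrite EFinD EFinM.
  rewrite ge0_integralD//; first last.
  - by apply: measurable_funeM; exact/measurable_EFinP.
  - by move=> t _; rewrite -EFinM lee_fin mulr_ge0// sqr_ge0.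
  rewrite ge0_integralZl//; first last.
  - by move=> t _; rewrite lee_fin sqr_ge0.
  - exact/measurable_EFinP.
  rewrite integral_cst// [X in (_ + _ * X)%E]probability_setT mule1.
  apply: (@le_trans _ _ ((r^-1 / 2)%:E * (n%:R)%:E + (r / 2)%:E)%E).
    apply: leeD => //; apply: lee_wpmul2l; first by rewrite lee_fin.
    have := deviation_square n 0 mh h01 hc; rewrite expr0n/= add0r; apply: le_trans.
    by rewrite le_eqVlt; apply/orP; left; apply/eqP; apply: eq_integral => t _; rewrite add0r.
  rewrite -EFinM -EFinD lee_fin -rr le_eqVlt; apply/orP; left; apply/eqP.
  by field; exact: lt0r_neq0.
have Ii j : fine (I i) <= fine (I j) + 2 * e.
  rewrite -lee_fin EFinD -!IE; exact: (swap_coordinate i j mA ms sp se mh h01).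
have nI : n%:R * fine (I i) <= n%:R * c * p + r + n%:R * (2 * e).
  have -> : n%:R * fine (I i) = \sum_(j < n) fine (I i).
    by rewrite sumr_const card_ord mulr_natl.
  apply: (@le_trans _ _ (\sum_(j < n) (fine (I j) + 2 * e))); first exact: ler_sum.
  by rewrite big_split/= sumr_const card_ord -[(2 * e) *+ n]mulr_natl lerD2r.
rewrite -/(I i) IE lee_fin -/p -/r -(ler_pM2l (_ : 0 < n%:R)) ?ltr0n//.
apply: (le_trans nI); rewrite le_eqVlt; apply/orP; left; apply/eqP.
by rewrite -rr; field; exact: lt0r_neq0.
Qed.

(** Invariance of the level sets of [s] is invariance of [s]: a point of a level set keeps
    its value under a permutation. *)
Lemma L2_symmetric_permute n (s : n.-tuple Y -> R) : L2_symmetric nu s ->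
  forall (p : 'S_n) t, s (permute_coord p t) = s t.
Proof.
move=> [_ sB] p t; have [_ /(_ p) H] := sB [set s t] (measurable_set1 _).
by have : (permute_coord p @^-1` (s @^-1` [set s t])) t by rewrite H.
Qed.

Lemma symmetric_approximation n (g : n.-tuple Y -> R) (e : R) : 0 < e ->
  g \in Lfun (power_measure nu n) 2%:E ->
  exists2 s, L2_symmetric nu s &
    (\int[power_measure nu n]_t `|g t - s t|%:E <= (dist_L2_symmetric nu g + e)%:E)%E.
Proof.
move=> e0 gL; set P := power_measure nu n.
pose N := [set fine ('N[P]_2%:E [EFin \o (g \- h)%R])%E | h in @L2_symmetric _ _ _ nu n].
have hN : has_inf N.
  split; last by exists 0 => _ [h _ <-]; rewrite fine_ge0// Lnorm_ge0.
  exists (fine ('N[P]_2%:E [EFin \o (g \- cst 0)%R])%E), (cst 0) => //.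
  split; first exact: Lfun_cst.
  move=> B mB; split; last by move=> p; apply/seteqP; split.
  exact: measurable_preimage (measurable_cst _) mB.
have [_ [s sS <-] sd] := inf_adherent e0 hN.
exists s => //; have sL := sS.1.
have gsL : (g \- s) \in Lfun P 2%:E.
  have [_ DL] := Lfun_addr_closed P (lee1n 2).
  have NL := @Lfun_oppr_closed _ _ _ P 2%:E.
  by apply: (DL g (- s) gL); apply: (NL s); exact: sS.1.
have /andP[] := gsL; rewrite !inE/= => mgs fgs.
apply: (le_trans (integral_abs_le_norm2 P mgs)).
rewrite -[leLHS]fineK ?lee_fin; first exact: ltW sd.
by rewrite ge0_fin_numE// Lnorm_ge0.
Qed.

End symmetric.

Section one_coordinate_bound.
Context (R : realType) (S : automorphism R).
Local Notation nu := (aut_measure S).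

Lemma one_coordinate_bound n (A : set (n.-tuple S)) (H : n.-tuple S -> R) (c e : R) :
  measurable A -> one_coordinate H -> 0 < e ->
  (\int[power_measure nu n]_t (H t)%:E = c%:E)%E ->
  (\int[power_measure nu n]_(t in A) (H t)%:E <=
    (c * fine (power_measure nu n A) + (Num.sqrt n%:R)^-1 +
     2 * (dist_L2_symmetric nu (\1_A : n.-tuple S -> R) + e))%:E)%E.
Proof.
move=> mA H1 e0 Hc; set P := power_measure nu n.
have AL : (\1_A : n.-tuple S -> R) \in Lfun P 2%:E by exact: Lfun_indic.
have [s sS se] := symmetric_approximation e0 AL.
have /andP[ms _] := sS.1; rewrite inE/= in ms.
case: H1 Hc => [[k k01 ->]|[i [h [mh h01 ->]]]] Hc.
  rewrite integral_cst// -[X in (_ * X)%E](probability_fineK P mA) -EFinM lee_fin.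
  have -> : k = c.
    by move: Hc; rewrite integral_cst// [X in (_ * X)%E]probability_setT mule1 => -[].
  rewrite -addrA lerDl addr_ge0// mulr_ge0// -lee_fin; apply: le_trans se.
  by apply: integral_ge0 => t _; rewrite lee_fin.
apply: (symmetric_coordinate_bound i mA ms (L2_symmetric_permute sS) se mh h01).
by rewrite -Hc; apply/esym/integral_coord => // y; case/andP: (h01 y).
Qed.

End one_coordinate_bound.

(** * Disjointness *)

Lemma ae_pullback (R : realType) d e (W : measurableType d) (V : measurableType e)
  (P : probability W R) (Q : probability V R) (theta : W -> V) (U : V -> Prop) :
  measurable_fun setT theta -> (forall A, measurable A -> P (theta @^-1` A) = Q A) ->
  {ae Q, forall y, U y} -> {ae P, forall x, U (theta x)}.
Proof.
move=> mt PQ [N [mN N0 UN]]; exists (theta @^-1` N); split.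
- exact: measurable_preimage.
- by rewrite PQ.
- by move=> x /= nU; exact: (UN (theta x)).
Qed.

Section lift.
Context (R : realType) (T Z S : automorphism R) (phi : S -> T).
Local Notation mu := (aut_measure T).
Local Notation rho := (aut_measure Z).
Local Notation P := (aut_measure S).
Hypothesis phiF : factor_map P (aut_map S) mu (aut_map T) phi.
Context (lam : probability (T * Z)%type R).
Hypothesis jlam : joining mu (aut_map T) rho (aut_map Z) lam.

(** With [f E] the conditional probability of [E] given [T], the relatively independent
    joining gives [(E, D)] the integral of [f E \o phi] over [D]. It is additive in [D] by
    construction, while additivity in [E] and invariance come from the almost everywhere
    uniqueness of densities. *)
Lemma lift_joining : exists2 m, @coupling_set R Z S m &
  forall A E, measurable A -> measurable E -> (m (E, phi @^-1` A))%:E = lam (A `*` E).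
Proof.
have [mphi phiP phiS] := phiF; have [lam1 lam2 laminv] := jlam.
have /choice[f fP] : forall E : set Z, exists h : T -> R, measurable E ->
    [/\ measurable_fun setT h, forall x, 0 <= h x <= 1 &
        forall A, measurable A -> lam (A `*` E) = (\int[mu]_(x in A) (h x)%:E)%E].
  move=> E; have [mE|nE] := pselect (measurable E); last by exists (fun=> 0).
  have [h [mh h01 hE]] := conditional_density measurable_fst
    (measurable_preimage measurable_snd mE) lam1.
  exists h => _; split => // A mA; rewrite -hE//; congr (lam _).
  by apply/seteqP; split => -[x z] /= [].
have mf E : measurable E -> measurable_fun setT (f E) by case/fP.
have f01 E x : measurable E -> 0 <= f E x <= 1 by case/fP.
have f0 E x : measurable E -> 0 <= f E x by move=> mE; case/andP: (f01 E x mE).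
have fE E A : measurable E -> measurable A -> lam (A `*` E) = (\int[mu]_(x in A) (f E x)%:E)%E.
  by case/fP => _ _; apply.
have mfphi E : measurable E -> measurable_fun setT (fun t => (f E (phi t))%:E).
  by move=> mE; apply/measurable_EFinP; exact: measurableT_comp (mf E mE) mphi.
pose M (p : set Z * set S) := (\int[P]_(t in p.2) (f p.1 (phi t))%:E)%E.
(* The value [0] on pairs of other sets keeps [m] in [[0, 1]]: [f E] is arbitrary when [E] is
   not measurable. *)
pose m (p : set Z * set S) : R :=
  if `[< measurable p.1 /\ measurable p.2 >] then fine (M p) else 0.
have M01 E D : measurable E -> measurable D -> (0 <= M (E, D) <= 1)%E.
  move=> mE mD; rewrite integral_ge0/= => [|t _]; last by rewrite lee_fin f0.
  apply: (@le_trans _ _ (P D)); last exact: probability_le1.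
  rewrite -[leRHS]mul1e -integral_cst//; apply: ge0_le_integral => //.
  - by move=> t _; rewrite lee_fin f0.
  - exact: measurable_funTS (mfphi E mE).
  - by move=> t _; rewrite lee_fin; case/andP: (f01 E (phi t) mE).
have mM E D : measurable E -> measurable D -> (m (E, D))%:E = M (E, D).
  move=> mE mD; rewrite /m asboolT//.
  have /andP[a b] := M01 E D mE mD; rewrite fineK// fin_numElt (lt_le_trans _ a) ?ltNyr//.
  by rewrite (le_lt_trans b) ?ltry.
have M_image E A : measurable E -> measurable A -> M (E, phi @^-1` A) = lam (A `*` E).
  move=> mE mA; rewrite fE// (integral_image mphi phiP mA)//.
    by apply/measurable_EFinP; exact: mf.
  by move=> x; rewrite lee_fin f0.
exists m; last first.
  by move=> A E mA mE; rewrite mM ?M_image//; exact: measurable_preimage.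
have transfer E' (h : T -> R) D : measurable D -> measurable_fun setT h ->
    measurable E' -> {ae mu, forall x, f E' x = h x} ->
    M (E', D) = (\int[P]_(t in D) (h (phi t))%:E)%E.
  move=> mD mh mE' fh; apply: ae_eq_integral => //.
  - exact: measurable_funTS (mfphi E' mE').
  - by apply: measurable_funTS; apply/measurable_EFinP; exact: measurableT_comp mh mphi.
  - by apply: filterS (ae_pullback mphi phiP fh) => t /= -> _.
have [f' [fK f'K mT mT' muT]] := aut_invertible T.
have [g' [gK g'K mS mS' PS]] := aut_invertible S.
split; first split.
- move=> [E D]; rewrite /m; case: asboolP => [[mE mD]|_]; last by rewrite lexx ler01.
  have /andP[a b] := M01 E D mE mD; rewrite fine_ge0//=.
  by rewrite -lee_fin fineK// fin_numElt (lt_le_trans _ a) ?ltNyr// (le_lt_trans b) ?ltry.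
- move=> E E' D mE mE' mD EE'; apply: EFin_inj; rewrite EFinD !mM//; last exact: measurableU.
  have mEE' : measurable (E `|` E') by exact: measurableU.
  have fD : {ae mu, forall x, f (E `|` E') x = f E x + f E' x}.
    apply: density_ae_unique => // [|||A mA].
    + exact: mf.
    + by apply: measurable_funD; exact: mf.
    + by move=> x; exact: f01.
    + under [RHS]eq_integral do rewrite EFinD.
      rewrite ge0_integralD//; first last.
      * by apply: measurable_funTS; apply/measurable_EFinP; exact: mf.
      * by move=> x _; rewrite lee_fin f0.
      * by apply: measurable_funTS; apply/measurable_EFinP; exact: mf.
      * by move=> x _; rewrite lee_fin f0.
      rewrite -!fE// -measureU//; try exact: measurableX.
        congr (lam _); apply/seteqP; split => -[x z] /=; first by move=> [Ax [Ez|Ez]]; [left|right].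
        by move=> [[Ax Ez]|[Ax Ez]]; split => //; [left|right].
      apply/seteqP; split => -[x z] //= [[_ Ez] [_ E'z]].
      by have : (E `&` E') z by []; rewrite EE'.
  rewrite (transfer _ _ _ mD _ mEE' fD)//; last by apply: measurable_funD; exact: mf.
  under eq_integral do rewrite EFinD.
  rewrite ge0_integralD//; try exact: measurable_funTS (mfphi _ _).
  + by move=> x _; rewrite lee_fin f0.
  + by move=> x _; rewrite lee_fin f0.
- move=> E D D' mE mD mD' DD'; apply: EFin_inj; rewrite EFinD !mM//; last exact: measurableU.
  rewrite /M/= ge0_integral_setU//.
  + exact: measurable_funTS (mfphi _ _).
  + by move=> x _; rewrite lee_fin f0.
  + exact/disj_set2P.
- move=> E mE; rewrite mM// -(preimage_setT phi) M_image// -lam2//.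
  by congr (lam _); apply/seteqP; split => -[x z] //= [].
- move=> D mD; rewrite mM//.
  have f1 : {ae mu, forall x, f setT x = (fun=> 1) x}.
    apply: (density_ae_unique (h2 := fun=> 1)) => // [||A mA].
    + exact: mf.
    + by move=> x; exact: f01.
    + rewrite -fE// integral_cst// mul1e -[RHS]lam1//; congr (lam _).
      by apply/seteqP; split => -[x z] //= [].
  by rewrite (transfer _ _ _ mD _ measurableT f1)// integral_cst// mul1e.
- move=> E D mE mD; have mZ := aut_measurable (S := Z).
  have mE' : measurable (aut_map Z @^-1` E) by exact: measurable_preimage.
  have mD' : measurable (aut_map S @^-1` D) by exact: measurable_preimage.
  apply: EFin_inj; rewrite !mM//.
  have fT : {ae mu, forall x, f (aut_map Z @^-1` E) x = f E (aut_map T x)}.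
    apply: density_ae_unique => // [|||A mA].
    + exact: mf.
    + exact: measurableT_comp (mf E mE) mT.
    + by move=> x; exact: f01.
    + have AE : A = aut_map T @^-1` (f' @^-1` A).
        by rewrite -comp_preimage (_ : f' \o aut_map T = id)//; apply/funext => x /=; rewrite fK.
      have mA' : measurable (f' @^-1` A) by exact: measurable_preimage.
      rewrite [in RHS]AE -(integral_image mT muT mA' (f := fun x => (f E x)%:E)); first last.
      * by move=> x; rewrite lee_fin f0.
      * by apply/measurable_EFinP; exact: mf.
      rewrite -!fE// [in LHS]AE -[RHS]laminv//; exact: measurableX.
  rewrite (transfer _ _ _ mD' _ mE' fT)//; last exact: measurableT_comp (mf E mE) mT.
  rewrite /M /= (integral_image mS PS mD (mfphi E mE)) => [|t]; last by rewrite lee_fin f0.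
  apply: ae_eq_integral => //.
  + apply: measurable_funTS; apply/measurable_EFinP.
    exact: measurableT_comp (measurableT_comp (mf E mE) mT) mphi.
  + by apply: measurable_funTS; exact: measurableT_comp (mfphi E mE) mS.
  + by apply: filterS phiS => t /= -> _.
Qed.

End lift.

Section rectangle_bound.
Context (R : realType) (T Z S : automorphism R) (n : nat) (phi : n.-tuple S -> T).
Local Notation mu := (aut_measure T).
Local Notation rho := (aut_measure Z).
Local Notation nu := (aut_measure S).
Hypotheses (jpZ : joining_primeness Z) (wS : weakly_mixing nu (aut_map S)).
Hypothesis phiF : factor_map (power_measure nu n) (power_map n (aut_map S)) mu (aut_map T) phi.
Context (lam : probability (T * Z)%type R).
Hypothesis jlam : joining mu (aut_map T) rho (aut_map Z) lam.

Lemma joining_rectangle_le A E e : measurable A -> measurable E -> 0 < e ->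
  fine (lam (A `*` E)) <= fine (mu A) * fine (rho E) + (Num.sqrt n%:R)^-1 +
    2 * (dist_L2_symmetric nu ((\1_A : T -> R) \o phi) + e).
Proof.
move=> mA mE e0; have [mphi phiP _] := phiF.
have mAE : measurable (A `*` E) by exact: measurableX.
pose Sn := power_automorphism S n.
have [m Km mlam] := @lift_joining R T Z Sn phi phiF lam jlam.
have eSn : ergodic (aut_measure Sn) (aut_map Sn).
  exact: weakly_mixing_ergodic (power_weakly_mixing wS).
have mphA : measurable (phi @^-1` A) by exact: measurable_preimage.
have [lam' elam' mle] := ergodic_joining_above jpZ.1 eSn Km mE mphA.
have [H H1 HE] := jp_power jpZ wS elam' mE.
have Hc : (\int[power_measure nu n]_t (H t)%:E = (fine (rho E))%:E)%E.
  have [[lam'1 _ _] _] := elam'.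
  rewrite -HE// probability_fineK// -(lam'1 _ mE); congr (lam' _).
  by apply/seteqP; split => -[z t] //= [].
have := one_coordinate_bound mphA H1 e0 Hc.
rewrite -HE// => /(le_trans mle); rewrite mlam// -(probability_fineK lam mAE) lee_fin.
rewrite [fine (rho E) * _]mulrC (phiP _ mA).
suff -> : (\1_A : T -> R) \o phi = \1_(phi @^-1` A) by [].
by apply/funext => t; rewrite /= !indicE; congr (_%:R); apply/idP/idP; rewrite !inE.
Qed.

End rectangle_bound.

(** The bound for the complement of [A] provides the reverse inequality, the marginals being
    fixed. *)
Lemma joining_le_disjoint (R : realType) (T Z : automorphism R)
  (lam : probability (T * Z)%type R) :
  joining (aut_measure T) (aut_map T) (aut_measure Z) (aut_map Z) lam ->
  (forall A E e, measurable A -> measurable E -> 0 < e ->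
    fine (lam (A `*` E)) <= fine (aut_measure T A) * fine (aut_measure Z E) + e) ->
  forall C, measurable C -> lam C = (aut_measure T \x aut_measure Z)%E C.
Proof.
move=> [lam1 lam2 _] le C mC.
have le' A E : measurable A -> measurable E ->
    fine (lam (A `*` E)) <= fine (aut_measure T A) * fine (aut_measure Z E).
  by move=> mA mE; apply/ler_addgt0Pr => e e0; exact: le.
apply: rect_prob_unique mC => A E mA mE.
rewrite [RHS]product_measure1E//.
have mAE : measurable (A `*` E) by exact: measurableX.
have mCE : measurable (~` A `*` E) by apply: measurableX => //; exact: measurableC.
have split_E : fine (aut_measure Z E) = fine (lam (A `*` E)) + fine (lam (~` A `*` E)).
  apply: EFin_inj; rewrite EFinD !probability_fineK// -lam2// -measureU//.
    congr (lam _); apply/seteqP; split => -[x z] /=; last by move=> [] [].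
    by have [Ax|nAx] := pselect (A x); [left|right].
  by apply/seteqP; split => -[x z] //= [[? ?] []].
have split_A : fine (aut_measure T (~` A)) = 1 - fine (aut_measure T A).
  apply: EFin_inj; rewrite EFinB !probability_fineK//; last exact: measurableC.
  exact: probability_setC.
rewrite -(probability_fineK lam mAE) -[X in (_ = X * _)%E](probability_fineK (aut_measure T) mA).
rewrite -[X in (_ = _ * X)%E](probability_fineK (aut_measure Z) mE) -EFinM; congr (_%:E).
apply/eqP; rewrite eq_le le'//=.
have := le' _ _ (measurableC mA) mE; rewrite split_A mulrBl mul1r => H.
by lra.
Qed.

Theorem proposition5 (R : realType) (T : automorphism R)
  (hT : forall g : T -> R, g \in Lfun (aut_measure T) 2%:E ->
    exists (k : nat -> nat) (S : nat -> automorphism R)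
           (phi : forall j, (k j).-tuple (S j) -> T),
      [/\ forall j, (0 < k j)%N,
          k @ \oo --> \oo,
          forall j, weakly_mixing (aut_measure (S j)) (aut_map (S j)),
          forall j, factor_map
            (power_measure (aut_measure (S j)) (k j))
            (power_map (k j) (aut_map (S j)))
            (aut_measure T) (aut_map T) (phi j) &
          (fun j => dist_L2_symmetric (aut_measure (S j)) (g \o phi j))
            =o_\oo (fun j => (Num.sqrt (k j)%:R)^-1)]) :
  forall Z : automorphism R,
    weakly_mixing (aut_measure Z) (aut_map Z) -> joining_primeness Z ->
    disjoint_systems (aut_measure T) (aut_map T) (aut_measure Z) (aut_map Z).
Proof.
move=> Z _ jpZ lam jlam; apply: (joining_le_disjoint jlam) => A E e mA mE e0.
have [k [S [phi [k0 koo wS phiF dist_o]]]] := hT (\1_A) (Lfun_indic _ mA).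
(* The error for [S j] is [r + 2 * (dist + eta)] with [r = (sqrt (k j))^-1]; if [r] and the
   distance are at most [eta] it is at most [5 * eta]. *)
pose eta := e / 5.
have eta0 : 0 < eta by rewrite divr_gt0.
have [N NE] : exists N : nat, eta^-1 ^+ 2 <= N%:R.
  by exists (Num.bound (eta^-1 ^+ 2)); rewrite ltW// archi_boundP// sqr_ge0.
have /eqoP/(_ 1 ltr01) dist_le := dist_o.
have kN : \forall j \near \oo, (N <= k j)%N by move/cvgnyPge : koo; exact.
have [j [dj kj]] : exists j, `|dist_L2_symmetric (aut_measure (S j)) (\1_A \o phi j)| <=
    1 * `|(Num.sqrt (k j)%:R)^-1 : R| /\ (N <= k j)%N.
  by have [j [? ?]] := filter_ex (filterI dist_le kN); exists j.
have rj : (Num.sqrt (k j)%:R)^-1 <= eta.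
  rewrite -[leRHS]invrK lef_pV2 ?posrE ?invr_gt0 ?sqrtr_gt0 ?ltr0n//.
  have -> : eta^-1 = Num.sqrt (eta^-1 ^+ 2) by rewrite sqrtr_sqr ger0_norm// invr_ge0 ltW.
  rewrite ler_wsqrtr//.
  by rewrite (le_trans NE)// ler_nat.
rewrite mul1r [X in _ <= X]ger0_norm ?invr_ge0 ?sqrtr_ge0// in dj.
have := joining_rectangle_le jpZ (wS j) (phiF j) jlam mA mE eta0.
move/le_trans; apply; rewrite -addrA lerD2l.
have := ler_norm (dist_L2_symmetric (aut_measure (S j)) (\1_A \o phi j)).
rewrite /eta in rj *; lra.
Qed.
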